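(* Let $\mathcal F=\{K_3\}$, $\kappa=5$, and let $\gamma(H)=0$ for every admissible graph $H$ of order 5 except $\gamma(C_5)=1$. Let $B=C_5$. Then the corresponding problem (maximising the number of induced 5-cycles in a triangle-free graph) is perfectly $B$-stable, and the unique maximiser of $\lambda(B(\mathbf a))$ over $\mathbf a\in\mathbb S_5$ is the vector with each entry equal to $1/5$.
   Context: All graphs are finite and simple; ''subgraph'' means induced subgraph. For graphs $F,G$, $P(F,G)$ is the number of $v(F)$-subsets of $V(G)$ inducing a copy of $F$, and $p(F,G)=P(F,G)/\binom{v(G)}{v(F)}$. Admissible graphs are those with no induced subgraph isomorphic to a member of $\mathcal F$; $\mathcal G$ is the class of admissible graphs, $\mathcal G^0_\kappa$ a set of isomorphism-class representatives of admissible graphs of order $\kappa$. With $\gamma:\mathcal G^0_\kappa\to\mathbb R$: $\Lambda(G)=\sum_{H}\gamma(H)P(H,G)$, $\lambda(G)=\Lambda(G)/\binom{v(G)}\kappa$, $\Lambda(n,\mathcal G)=\max\{\Lambda(G):G\in\mathcal G,v(G)=n\}$, $\lambda(n,\mathcal G)=\Lambda(n,\mathcal G)/\binom n\kappa$. For a graph $B$ on $[m]$ and disjoint sets $V_1,\dots,V_m$, the blow-up $B(V_1,\dots,V_m)$ is the graph on $\bigcup V_i$ with $u\in V_i$, $w\in V_j$ adjacent iff $ij\in E(B)$; $B()$ is the family of all blow-ups of $B$. $\mathbb S_m$ is the standard simplex of probability vectors in $\mathbb R^m$, and $\lambda(B(\mathbf a))=\lim_{n\to\infty}\lambda(B(V_{1,n},\dots,V_{m,n}))$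 with $|V_{i,n}|=a_in+O(1)$. $\delta_{\mathrm{edit}}(G,B())$ is the minimum number of adjacency changes turning $G$ (of order $n$) into a blow-up of $B$, divided by $\binom n2$. The problem is perfectly $B$-stable if there is $C>0$ such that every admissible $G$ of order $n\ge C$ satisfies $\delta_{\mathrm{edit}}(G,B())\le C(\lambda(n,\mathcal G)-\lambda(G))$. *)

(* Defs.v *)
From HB Require Import structures.
From mathcomp Require Import all_boot all_order all_algebra.
From mathcomp Require Import all_classical all_reals all_analysis.
Import Order.TTheory GRing.Theory Num.Theory.
Import numFieldNormedType.Exports.

Set Implicit Arguments.
Unset Strict Implicit.
Unset Printing Implicit Defensive.

Local Open Scope ring_scope.

Record sgraph (T : finType) := SGraph {
  adjf : {ffun T * T -> bool};
  _ : [forall x, ~~ adjf (x, x)] && [forall x, forall y, adjf (x, y) == adjf (y, x)] }.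

HB.instance Definition _ (T : finType) := [isSub for @adjf T].
HB.instance Definition _ (T : finType) := [Finite of sgraph T by <:].

Definition adj (T : finType) (G : sgraph T) : rel T := fun x y => adjf G (x, y).

Lemma adj_irr (T : finType) (G : sgraph T) : irreflexive (adj G).
Proof. by move=> x; case: G => f h; rewrite /adj /=; case/andP: h => /forallP h _; exact/negbTE/h. Qed.

Lemma adj_sym (T : finType) (G : sgraph T) : symmetric (adj G).
Proof. by move=> x y; case: G => f h; rewrite /adj /=; case/andP: h => _ /forallP/(_ x)/forallP/(_ y)/eqP. Qed.

Lemma of_rel_subproof (T : finType) (e : rel T) (ei : irreflexive e)
    (es : symmetric e) (f := [ffun p : T * T => e p.1 p.2]) :
  [forall x, ~~ f (x, x)] && [forall x, forall y, f (x, y) == f (y, x)].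
Proof.
apply/andP; split; first by apply/forallP => x; rewrite ffunE /= ei.
by apply/forallP => x; apply/forallP => y; rewrite !ffunE /= es.
Qed.

Definition of_rel (T : finType) (e : rel T) (ei : irreflexive e)
  (es : symmetric e) : sgraph T := SGraph (of_rel_subproof ei es).

Lemma adj_of_rel (T : finType) (e : rel T) (ei : irreflexive e)
  (es : symmetric e) : adj (of_rel ei es) =2 e.
Proof. by move=> x y; rewrite /adj ffunE. Qed.

Definition iso (S T : finType) (F : sgraph S) (G : sgraph T) : bool :=
  [exists f : {ffun S -> T},
    [&& injectiveb f, [forall y, y \in codom f] &
        [forall x, forall y, adj G (f x) (f y) == adj F x y]]].

Section Induced.
Variables (T : finType) (G : sgraph T) (A : {set T}).
Let e : rel {x : T | x \in A} := fun x y => adj G (val x) (val y).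
Fact induced_irr : irreflexive e. Proof. by move=> x; exact: adj_irr. Qed.
Fact induced_sym : symmetric e. Proof. by move=> x y; exact: adj_sym. Qed.
Definition induced : sgraph {x : T | x \in A} := of_rel induced_irr induced_sym.
End Induced.

(* A tuple of disjoint sets V_i (i : S), some possibly empty, with union T is
   encoded by the map c : T -> S sending each element of V_i to i. *)
Section Blowup.
Variables (S T : finType) (B : sgraph S) (c : T -> S).
Let e : rel T := fun u w => adj B (c u) (c w).
Fact blowup_irr : irreflexive e. Proof. by move=> x; exact: adj_irr. Qed.
Fact blowup_sym : symmetric e. Proof. by move=> x y; exact: adj_sym. Qed.
Definition blowup : sgraph T := of_rel blowup_irr blowup_sym.
End Blowup.

Definition is_blowup (S T : finType) (B : sgraph S) (G : sgraph T) : bool :=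
  [exists c : {ffun T -> S}, G == blowup B c].

Section Complete.
Variable n : nat.
Let e : rel 'I_n := fun i j => i != j.
Fact complete_irr : irreflexive e. Proof. by move=> i; rewrite /e eqxx. Qed.
Fact complete_sym : symmetric e. Proof. by move=> i j; rewrite /e eq_sym. Qed.
Definition complete : sgraph 'I_n := of_rel complete_irr complete_sym.
End Complete.

Section Cycle5.
Let e : rel 'I_5 := fun i j =>
  (j == (i.+1 %% 5)%N :> nat) || (i == (j.+1 %% 5)%N :> nat).
Fact C5_irr : irreflexive e. Proof. by case; do 5?case. Qed.
Fact C5_sym : symmetric e. Proof. by move=> i j; rewrite /e orbC. Qed.
Definition C5 : sgraph 'I_5 := of_rel C5_irr C5_sym.
End Cycle5.

Definition induced_count (S T : finType) (F : sgraph S) (G : sgraph T) : nat :=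
  #|[set A : {set T} | (#|A| == #|S|) && iso F (induced G A)]|.

Definition edges (T : finType) (G : sgraph T) : {set {set T}} :=
  [set [set p.1; p.2]%SET | p : T * T & adj G p.1 p.2].

Definition edit_count (T : finType) (G H : sgraph T) : nat :=
  #|(edges G :\: edges H) :|: (edges H :\: edges G)|.

(* The default value of the minimum is harmless: edit_count never exceeds the
   number of pairs. *)
Definition edit_dist (R : realType) (S T : finType) (G : sgraph T)
    (B : sgraph S) : R :=
  (\big[minn/'C(#|T|, 2)]_(H : sgraph T | is_blowup B H) edit_count G H)%:R
    / 'C(#|T|, 2)%:R.

Local Open Scope classical_set_scope.

Definition graph_family := set {n : nat & sgraph 'I_n}.

Definition triangle_family : graph_family :=
  [set Tagged (fun n => sgraph 'I_n) (complete 3)].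

Definition admissible (fam : graph_family) (T : finType) (G : sgraph T) : Prop :=
  forall F, fam F -> ~ exists A : {set T}, iso (tagged F) (induced G A).

Definition iso_representatives (fam : graph_family) (k : nat)
    (reps : {set sgraph 'I_k}) : Prop :=
  [/\ forall H, H \in reps -> admissible fam H,
      forall H : sgraph 'I_k, admissible fam H ->
        exists2 H', H' \in reps & iso H H' &
      forall H H', H \in reps -> H' \in reps -> iso H H' -> H = H'].

Section Problem.
Variables (R : realType) (fam : graph_family) (k : nat).
Variables (reps : {set sgraph 'I_k}) (gamma : sgraph 'I_k -> R).

Definition Lambda (T : finType) (G : sgraph T) : R :=
  \sum_(H in reps) gamma H * (induced_count H G)%:R.

Definition lambda (T : finType) (G : sgraph T) : R :=
  Lambda G / 'C(#|T|, k)%:R.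

(* Lambda takes finitely many values on graphs of order n, so this supremum is
   a maximum as soon as there is an admissible graph of order n. *)
Definition Lambda_max (n : nat) : R :=
  sup [set r | exists (T : finType) (G : sgraph T),
    [/\ #|T| = n, admissible fam G & r = Lambda G]].

Definition lambda_max (n : nat) : R := Lambda_max n / 'C(n, k)%:R.

Definition perfectly_stable (m : nat) (B : sgraph 'I_m) : Prop :=
  exists2 C : R, 0 < C &
    forall (T : finType) (G : sgraph T), admissible fam G -> C <= #|T|%:R ->
      edit_dist R G B <= C * (lambda_max #|T| - lambda G).

Definition simplex (m : nat) : set 'rV[R]_m :=
  [set a | (forall i, 0 <= a 0 i) /\ \sum_i a 0 i = 1].

(* "lambda(B(a)) = l": convergence to l for every choice of part sizes
   a_i n + O(1). *)
Definition is_blowup_density (m : nat) (B : sgraph 'I_m) (a : 'rV[R]_m)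
    (l : R) : Prop :=
  forall (T : nat -> finType) (c : forall n, T n -> 'I_m),
    (forall i, exists K : R, forall n,
       `|#|[set v | c n v == i]%SET|%:R - a 0 i * n%:R| <= K) ->
    (fun n => lambda (blowup B (c n))) @ \oo --> l.

Definition unique_density_maximiser (m : nat) (B : sgraph 'I_m)
    (a : 'rV[R]_m) : Prop :=
  exists2 f : 'rV[R]_m -> R,
    forall x, simplex x -> is_blowup_density B x (f x) &
    [set x | simplex x /\ forall y, simplex y -> f y <= f x] = [set a].

End Problem.

(* Main.v *)
Require Import Defs.
From Stdlib Require Import ZArith.
From mathcomp Require Import all_boot all_order all_algebra.
From mathcomp Require Import all_classical all_reals all_analysis.
From mathcomp Require Import ssrZ zify ring lra.
Import Order.TTheory GRing.Theory Num.Theory.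
Import numFieldNormedType.Exports.

(* Maps 'I_5 -> T sample five vertices with replacement, which amounts to
   replacing G by its limit of uniform blow-ups; hence a sum-of-squares
   certificate gives an inequality without error terms: if G is triangle-free of
   order n with p pentagons, then 5^5 p <= n^5 - c d, where d counts the induced
   labelled copies of P5 and P4 + K1 in G.

   Given an induced pentagon f, sort the vertices v by the trace of N(v) on f. If
   the trace is {f (i - 1), f (i + 1)}, put v in class i; otherwise v is bad, and
   then v and some four vertices of f span P4 + K1. Triangle-freeness rules out
   surplus edges between good vertices, and a missing edge between consecutive
   classes creates an induced P5. Averaging over f, some f has
   n^3 D = O(n^5 - 5^5 p), where D counts the pairs that are missing or contain a
   bad vertex; D bounds the edit distance.

   The maximum over graphs of order n is n^5 / 5^5 - O(n^3). If there is a bad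
   vertex, then D >= n, so this error term is absorbed. If there is none, then G
   is a subgraph of a blow-up H of C5 with parts of linear size, every pentagon
   of G is one of H, and every missing edge destroys at least c n^3 pentagons of
   H, so one compares directly with H.

   The number of pentagons of a blow-up is the product of the part sizes, so the
   uniqueness of the maximiser is the equality case of AM-GM. *)

Set Implicit Arguments.
Unset Strict Implicit.
Unset Printing Implicit Defensive.

Local Open Scope ring_scope.
(* MathComp rebinds %Z to the scope of [int]. *)
Delimit Scope Z_scope with BZ.

(** * A sum-of-squares inequality for pentagons *)

(** Indices are plain [nat] so that the certificate runs under [vm_compute]; only those below 5
    matter. *)
Definition mat := nat -> nat -> bool.

Definition is_C5 (A : mat) : bool :=
  [&& A 0 1, A 1 2, A 2 3, A 3 4, A 0 4, ~~ A 0 2, ~~ A 0 3, ~~ A 1 3,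
      ~~ A 1 4 & ~~ A 2 4]%N.

Definition is_P5 (A : mat) : bool :=
  [&& A 0 1, A 1 2, A 2 3, A 3 4, ~~ A 0 2, ~~ A 0 3, ~~ A 0 4, ~~ A 1 3,
      ~~ A 1 4 & ~~ A 2 4]%N.

Definition is_P4K1 (A : mat) : bool :=
  [&& A 0 1, A 1 2, A 2 3, ~~ A 0 2, ~~ A 0 3, ~~ A 1 3, ~~ A 0 4, ~~ A 1 4,
      ~~ A 2 4 & ~~ A 3 4]%N.

Definition is_empty_root (xy yz xz : bool) : bool := [&& ~~ xy, ~~ yz & ~~ xz].
Definition is_edge_root (xy yz xz : bool) : bool := [&& xy, ~~ yz & ~~ xz].
Definition is_path_root (xy yz xz : bool) : bool := [&& xy, yz & ~~ xz].

(* With roots x, y, z = 0, 1, 2 and v any vertex, [root] tests the graph induced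
   by the roots (on xy, yz, xz) and [flag] the adjacencies of v to x, y, z; the
   square itself is the sum over (x, y, z) satisfying [root] of
   [weight * (\sum_v flag)^2]. *)
Record square := Square {
  weight : Z;
  root : bool -> bool -> bool -> bool;
  flag : bool -> bool -> bool -> Z }.

(* A flag algebra certificate, found numerically and then rounded. For every
   choice of roots in the balanced blow-up of C5 the sum of each flag over v
   vanishes, as it must because the inequality is tight there. *)
Definition squares : seq square :=
  [:: Square 8 is_empty_root (fun a b c =>
        if a then if b then if c then -3 else 4 else if c then 4 else -5
        else if b then if c then 4 else -5 else if c then -5 else 2)%BZ;
      Square 63 is_edge_root (fun a b c =>
        if a || b then if c then 2 else -1 else if c then 6 else -2)%BZ;
      Square 129 is_edge_root (fun a b c =>
        if a || b then if c then -1 else 2 else if c then 0 else -2)%BZ;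
      Square 37 is_edge_root (fun a b c => if a || b then if c then -1 else 1 else 0)%BZ;
      Square 72 is_edge_root (fun a b c =>
        if c then 0 else if a then 1 else if b then -1 else 0)%BZ;
      Square 2928 is_edge_root (fun a b c =>
        if c then if a then 1 else if b then -1 else 0 else 0)%BZ;
      Square 256 is_path_root (fun a b c =>
        if b then 1 else if a then if c then 0 else -1 else if c then -1 else -2)%BZ;
      Square 62 is_path_root (fun a b c =>
        if b then 0 else if a then if c then 2 else -1 else if c then -1 else -4)%BZ;
      Square 2616 is_path_root (fun a b c =>
        if b then 0 else if a then if c then 0 else 1 else if c then -1 else 0)%BZ].

Definition square_term (A : mat) (q : square) : Z :=
  if root q (A 0 1)%N (A 1 2)%N (A 0 2)%N then
    (weight q * (flag q (A 0 3)%N (A 1 3)%N (A 2 3)%N * flag q (A 0 4)%N (A 1 4)%N (A 2 4)%N))%BZ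
  else 0%BZ.

(* Summed over all maps 'I_5 -> T, this is
   [32 n^5 - 10000 #pentagons - 48 #defects - squares]. It is not pointwise
   nonnegative, only its average over relabellings is. *)
Definition deficit (A : mat) : Z :=
  (32 - (if is_C5 A then 10000 else 0) - (if is_P5 A || is_P4K1 A then 48 else 0)
     - foldr (fun q s => square_term A q + s) 0 squares)%BZ.

Fixpoint insertions (x : nat) (s : seq nat) : seq (seq nat) :=
  if s is y :: s' then (x :: s) :: [seq y :: t | t <- insertions x s']
  else [:: [:: x]].

Definition perms5 : seq (seq nat) :=
  foldr (fun x ps => flatten [seq insertions x p | p <- ps]) [:: [::]] (iota 0 5).

Definition table (A : mat) : seq (seq bool) :=
  [seq [seq A i j | j <- iota 0 5] | i <- iota 0 5].

Definition mat_of (s : seq (seq bool)) : mat := fun i j => nth false (nth [::] s i) j.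

Definition permute (p : seq nat) (s : seq (seq bool)) : seq (seq bool) :=
  [seq [seq nth false r j | j <- p] | r <- [seq nth [::] s i | i <- p]].

Definition sym_table (a01 a02 a03 a04 a12 a13 a14 a23 a24 a34 : bool) :=
  [:: [:: false; a01; a02; a03; a04];
      [:: a01; false; a12; a13; a14];
      [:: a02; a12; false; a23; a24];
      [:: a03; a13; a23; false; a34];
      [:: a04; a14; a24; a34; false]].

Definition sym_deficit (s : seq (seq bool)) : Z :=
  foldr (fun p z => deficit (mat_of (permute p s)) + z)%BZ 0%BZ perms5.

Definition triangle_free5 (s : seq (seq bool)) : bool :=
  all (fun r => all (fun i => nth false r i ==> 
    all (fun j => nth false r j ==> ~~ nth false (nth [::] s i) j) (iota 0 5)) (iota 0 5)) s.

Definition forallb (P : bool -> bool) : bool := P true && P false.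

Lemma forallbP (P : bool -> bool) b : forallb P -> P b.
Proof. by case: b; case/andP. Qed.

(** The finite check behind the certificate, over all $2^{10}$ labelled graphs on five vertices.
    Sampling with replacement is covered too: a repeated vertex shows up as nonadjacent twins. *)
Lemma sym_deficit_ge0_compute :
  forallb (fun a01 => forallb (fun a02 => forallb (fun a03 => forallb (fun a04 =>
  forallb (fun a12 => forallb (fun a13 => forallb (fun a14 => forallb (fun a23 =>
  forallb (fun a24 => forallb (fun a34 =>
    let s := sym_table a01 a02 a03 a04 a12 a13 a14 a23 a24 a34 in
    triangle_free5 s ==> (0 <=? sym_deficit s)%BZ)))))))))).
Proof. by vm_compute. Qed.

Definition triangle_free (T : finType) (G : sgraph T) : Prop :=
  forall x y z, ~~ [&& adj G x y, adj G y z & adj G x z].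

Definition ffun_mat (T : finType) (G : sgraph T) (f : {ffun 'I_5 -> T}) : mat :=
  fun i j => adj G (f (inord i)) (f (inord j)).

Lemma table_ffun_mat (T : finType) (G : sgraph T) (f : {ffun 'I_5 -> T})
    (A := ffun_mat G f) :
  table A = sym_table (A 0 1) (A 0 2) (A 0 3) (A 0 4) (A 1 2) (A 1 3) (A 1 4)
                      (A 2 3) (A 2 4) (A 3 4)%N.
Proof.
have sA i j : A i j = A j i by exact: adj_sym.
have iA i : A i i = false by exact: adj_irr.
rewrite /table /sym_table /= !iA (sA 1%N 0%N) (sA 2%N 0%N) (sA 3%N 0%N) (sA 4%N 0%N).
by rewrite (sA 2%N 1%N) (sA 3%N 1%N) (sA 4%N 1%N) (sA 3%N 2%N) (sA 4%N 2%N) (sA 4%N 3%N).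
Qed.

Lemma nth_table (A : mat) i j : (i < 5)%N -> (j < 5)%N ->
  nth false (nth [::] (table A) i) j = A i j.
Proof.
move=> hi hj; rewrite (nth_map 0%N) ?size_iota // (nth_map 0%N) ?size_iota //.
by rewrite !nth_iota.
Qed.

Lemma triangle_free_table (T : finType) (G : sgraph T) (f : {ffun 'I_5 -> T}) :
  triangle_free G -> triangle_free5 (table (ffun_mat G f)).
Proof.
move=> tf; apply/allP => r /(nthP [::])[k]; rewrite size_map size_iota => hk <-.
apply/allP => i; rewrite mem_iota => hi; apply/implyP.
rewrite nth_table // => aki.
apply/allP => j; rewrite mem_iota => hj; apply/implyP; rewrite !nth_table // => akj.
by apply/negP => aij; have := tf (f (inord k)) (f (inord i)) (f (inord j));
  rewrite [adj _ _ _]aki [adj _ _ _]aij [adj _ _ _]akj.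
Qed.

Lemma sym_deficit_ge0 (T : finType) (G : sgraph T) (f : {ffun 'I_5 -> T}) :
  triangle_free G -> (0 <= sym_deficit (table (ffun_mat G f)))%BZ.
Proof.
move=> tf; have := triangle_free_table f tf; rewrite table_ffun_mat => tf5.
apply/Z.leb_le; apply: implyP tf5; set A := ffun_mat G f.
have H := sym_deficit_ge0_compute.
have {}H := forallbP (A 0 1)%N H; have {}H := forallbP (A 0 2)%N H.
have {}H := forallbP (A 0 3)%N H; have {}H := forallbP (A 0 4)%N H.
have {}H := forallbP (A 1 2)%N H; have {}H := forallbP (A 1 3)%N H.
have {}H := forallbP (A 1 4)%N H; have {}H := forallbP (A 2 3)%N H.
have {}H := forallbP (A 2 4)%N H; exact: (forallbP (A 3 4)%N H).
Qed.

Lemma eq_deficit (A B : mat) :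
  (forall i j, (i < 5)%N -> (j < 5)%N -> A i j = B i j) -> deficit A = deficit B.
Proof.
move=> e; rewrite /deficit /= /square_term /= /is_C5 /is_P5 /is_P4K1.
by rewrite /is_empty_root /is_edge_root /is_path_root !e.
Qed.

Lemma perms5P p : p \in perms5 -> perm_eq p (iota 0 5).
Proof. by move: p; apply/allP; vm_compute. Qed.

Lemma mat_of_permute (A : mat) p i j : p \in perms5 -> (i < 5)%N -> (j < 5)%N ->
  mat_of (permute p (table A)) i j = A (nth 0 p i)%N (nth 0 p j)%N.
Proof.
move=> /perms5P pp hi hj; have sp : size p = 5%N by rewrite (perm_size pp).
have lt5 k : (k < 5)%N -> (nth 0 p k < 5)%N.
  move=> hk; have : nth 0%N p k \in p by rewrite mem_nth // sp.
  by rewrite (perm_mem pp) mem_iota.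
rewrite /mat_of /permute (nth_map [::]) ?size_map ?sp //.
by rewrite (nth_map 0%N) ?sp // (nth_map 0%N) ?sp // nth_table ?lt5.
Qed.

Lemma sum_ffun_perm (T : finType) (F : mat -> Z) (G : sgraph T) p :
  p \in perms5 ->
  (forall A B : mat, (forall i j, (i < 5)%N -> (j < 5)%N -> A i j = B i j) -> F A = F B) ->
  \sum_(f : {ffun 'I_5 -> T}) F (mat_of (permute p (table (ffun_mat G f)))) =
  \sum_(f : {ffun 'I_5 -> T}) F (ffun_mat G f).
Proof.
move=> pp eF; have pe := perms5P pp.
have sp : size p = 5%N by rewrite (perm_size pe).
have lt5 k : (k < 5)%N -> (nth 0 p k < 5)%N.
  move=> hk; have : nth 0%N p k \in p by rewrite mem_nth // sp.
  by rewrite (perm_mem pe) mem_iota.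
pose s (i : 'I_5) : 'I_5 := inord (nth 0%N p i).
have s_inj : injective s.
  move=> i j /(congr1 val); rewrite /= !inordK ?lt5 // => /eqP.
  by rewrite nth_uniq ?sp ?(perm_uniq pe) ?iota_uniq // => /eqP/val_inj.
have [t st ts] := injF_bij s_inj.
rewrite [RHS](reindex (fun f : {ffun 'I_5 -> T} => [ffun i => f (s i)])) /=.
  apply: eq_bigr => f _; apply: eF => i j hi hj; rewrite mat_of_permute //.
  by rewrite /ffun_mat !ffunE /s !inordK.
exists (fun f : {ffun 'I_5 -> T} => [ffun i => f (t i)]) => f _;
  by apply/ffunP => i; rewrite !ffunE ?st ?ts.
Qed.

(** Relabelling the five positions permutes the maps, so 120 times the sum equals the sum of the
    symmetrised deficits, each nonnegative by the finite check. *)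
Lemma sum_deficit_ge0 (T : finType) (G : sgraph T) : triangle_free G ->
  0 <= \sum_(f : {ffun 'I_5 -> T}) deficit (ffun_mat G f).
Proof.
move=> tf; set S := \sum_(f | _) _.
suff : 0 <= S *+ size perms5 by rewrite pmulrn_lge0.
have -> : S *+ size perms5 =
    \sum_(f : {ffun 'I_5 -> T}) sym_deficit (table (ffun_mat G f)).
  have -> : S *+ size perms5 = \sum_(p <- perms5) S.
    by rewrite big_const_seq count_predT iter_addr_0.
  under eq_big_seq => p pp.
    rewrite /S -(sum_ffun_perm G pp eq_deficit); over.
  rewrite exchange_big /=; apply: eq_bigr => f _.
  by rewrite /sym_deficit; elim: perms5 => [|p ps IH]; rewrite ?big_nil ?big_cons ?IH.
by apply: sumr_ge0 => f _; apply/(Z.leb_le 0)/sym_deficit_ge0.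
Qed.

Definition pentagons (T : finType) (G : sgraph T) : {set {ffun 'I_5 -> T}} :=
  [set f | is_C5 (ffun_mat G f)].

Definition defects (T : finType) (G : sgraph T) : {set {ffun 'I_5 -> T}} :=
  [set f | is_P5 (ffun_mat G f) || is_P4K1 (ffun_mat G f)].

Lemma big_ffun5 (T : finType) (F : T -> T -> T -> T -> T -> Z) :
  \sum_(f : {ffun 'I_5 -> T})
     F (f (inord 0)) (f (inord 1)) (f (inord 2)) (f (inord 3)) (f (inord 4)) =
  \sum_x \sum_y \sum_z \sum_v \sum_w F x y z v w.
Proof.
do 4 rewrite pair_big /=.
rewrite (reindex (fun f : {ffun 'I_5 -> T} =>
  (f (inord 0), f (inord 1), f (inord 2), f (inord 3), f (inord 4)))) //=.
exists (fun p => [ffun i : 'I_5 => nth p.2 [:: p.1.1.1.1; p.1.1.1.2; p.1.1.2; p.1.2] i]).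
  move=> f _; apply/ffunP => i; rewrite ffunE /=; case: i => -[|[|[|[|[|//]]]]] h /=;
  by congr (f _); apply/val_inj; rewrite /= inordK.
by case=> [[[[x y] z] v] w] _; rewrite !ffunE /= !inordK.
Qed.

(** Once the three roots are fixed, the sums over [v] and [w] factor into [weight q] times a
    square. *)
Lemma sum_square_term_ge0 (T : finType) (G : sgraph T) q : 0 <= weight q ->
  0 <= \sum_(f : {ffun 'I_5 -> T}) square_term (ffun_mat G f) q.
Proof.
move=> w0; pose a := adj G.
pose F x y z v w := if root q (a x y) (a y z) (a x z) then
  (weight q * (flag q (a x v) (a y v) (a z v) * flag q (a x w) (a y w) (a z w)))%BZ
  else 0.
have -> : \sum_(f : {ffun 'I_5 -> T}) square_term (ffun_mat G f) q =
    \sum_x \sum_y \sum_z \sum_v \sum_w F x y z v w by exact: (big_ffun5 F).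
rewrite /F.
apply: sumr_ge0 => x _; apply: sumr_ge0 => y _; apply: sumr_ge0 => z _.
case: (root q _ _ _) => /=; last by rewrite big1 // => v _; rewrite big1.
rewrite (_ : \sum_v _ = weight q * (\sum_v flag q (a x v) (a y v) (a z v)) ^+ 2).
  by rewrite mulr_ge0 // sqr_ge0.
rewrite expr2 big_distrl mulr_sumr /=; apply: eq_bigr => v _.
by rewrite big_distrr mulr_sumr.
Qed.

(** The nonnegative squares are dropped and the rest is divided by 16. A pentagon has 10 labellings,
    so it is charged $6250 = 2 \cdot 5^5$. *)
Lemma pentagon_inequality (T : finType) (G : sgraph T) : triangle_free G ->
  (625 * #|pentagons G| + 3 * #|defects G| <= 2 * #|T| ^ 5)%N.
Proof.
move=> /sum_deficit_ge0.
have dE A : deficit A = 32%BZ - (if is_C5 A then 10000%BZ else 0) -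
    (if is_P5 A || is_P4K1 A then 48%BZ else 0) - \sum_(q <- squares) square_term A q.
  rewrite /deficit; congr (_ - _ - _ - _)%BZ.
  by elim: squares => [|q s IH]; rewrite ?big_nil ?big_cons /= ?IH.
under eq_bigr do rewrite dE; rewrite !sumrB.
rewrite -!big_mkcond !sumr_const card_ffun card_ord exchange_big /=.
set S := \sum_(q <- squares) _.
have S0 : 0 <= S.
  have : all (fun q => 0 <= weight q) squares by [].
  rewrite /S; elim: squares => [|q s IH]; rewrite ?big_nil ?big_cons //=.
  by case/andP => q0 /IH h; rewrite addr_ge0 // sum_square_term_ge0.
have natZ n : (n%:R : Z) = Z.of_nat n by rewrite -[n in RHS]natn rmorph_nat.
rewrite -(mulr_natr 32%BZ) -(mulr_natr 10000%BZ) -(mulr_natr 48%BZ) !natZ !cardsE => H.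
have {}H : (0 <= 32 * Z.of_nat (#|T| ^ 5)
    - 10000 * Z.of_nat #|[pred f | is_C5 (ffun_mat G f)]|
    - 48 * Z.of_nat #|[pred f | is_P5 (ffun_mat G f) || is_P4K1 (ffun_mat G f)]|)%BZ.
  apply/(Z.leb_le 0); apply: le_trans H _.
  by rewrite lerBlDr lerDl.
move: H; set a := (#|T| ^ 5)%N; set b := #|_|; set c := #|_|.
move=> H; apply/ssrnat.leP; rewrite -plusE -!multE; Lia.lia.
Qed.

(** * Vertices and pairs that disagree with a pentagon *)

Lemma adj_C5E (i j : 'I_5) : adj C5 i j = (j == i + 1) || (i == j + 1).
Proof.
rewrite adj_of_rel /= -!(inj_eq val_inj) /=.
by case: i j => [[|[|[|[|[|//]]]]] hi] [[|[|[|[|[|//]]]]] hj].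
Qed.

Lemma all_I5 (P : pred 'I_5) :
  [&& P 0, P 1, P (1 + 1), P (1 + 1 + 1) & P (1 + 1 + 1 + 1)] -> forall i, P i.
Proof.
case/and5P => h0 h1 h2 h3 h4 [[|[|[|[|[|//]]]]] hi];
by [congr P: h0; apply: val_inj | congr P: h1; apply: val_inj
  | congr P: h2; apply: val_inj | congr P: h3; apply: val_inj
  | congr P: h4; apply: val_inj].
Qed.

Lemma adj_C5_shift (k i j : 'I_5) : adj C5 (k + i) (k + j) = adj C5 i j.
Proof. by rewrite !adj_C5E -!addrA !(inj_eq (addrI k)). Qed.

(** Translation moves [i] to 0, whose neighbours 1 and 4 are then tried. The case [i = j] is
    included, so that edges inside a class are excluded later as well. *)
Lemma C5_common_neighbor (i j : 'I_5) : ~~ adj C5 i j ->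
  exists k, adj C5 i k && adj C5 j k.
Proof.
rewrite -(subrKC i j) -{1}[i]addr0 adj_C5_shift => nij.
suff [k] : exists k, adj C5 0 k && adj C5 (j - i) k.
  by exists (i + k); rewrite -{1}[i]addr0 !adj_C5_shift.
apply/existsP; apply: contraR nij; rewrite negb_exists => /forallP h.
move: (j - i) (h 1) (h (1 + 1 + 1 + 1)) => {h} d h1 h4.
have : [|| adj C5 0 1 && adj C5 d 1,
    adj C5 0 (1 + 1 + 1 + 1) && adj C5 d (1 + 1 + 1 + 1) | adj C5 0 d].
  by clear; move: d; apply: all_I5; rewrite !adj_C5E.
by rewrite (negbTE h1) (negbTE h4).
Qed.

Lemma pentagonsP (T : finType) (G : sgraph T) (f : {ffun 'I_5 -> T}) :
  reflect (forall i j, adj G (f i) (f j) = adj C5 i j) (f \in pentagons G).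
Proof.
have inordE (i : 'I_5) : f i = f (inord i) by rewrite inord_val.
rewrite inE; apply: (iffP idP) => [|h]; last first.
  by rewrite /is_C5 /ffun_mat !h !adj_of_rel /= !inordK.
rewrite /is_C5 /ffun_mat => h i j.
wlog le_ij : i j / (i <= j)%N.
  by move=> W; case/orP: (leq_total i j) => /W // e; rewrite adj_sym e adj_sym.
case/and5P: h => h01 h12 h23 h34 /and5P[h04 n02 n03 n13 /andP[n14 n24]].
rewrite adj_of_rel /= (inordE i) (inordE j).
case: i j le_ij => [[|[|[|[|[|//]]]]] hi] [[|[|[|[|[|//]]]]] hj] //= _;
  rewrite ?adj_irr //; do ?[exact/negbTE]; by [].
Qed.

(** Translate so that 0 is in the set. Then 1 and 4 are not, and at most one of 2 and 3 is;
    $\{0,2\}$ and $\{0,3\}$ are the neighbourhoods of 1 and 4. *)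
Lemma C5_independent (a : 'I_5 -> bool) : (forall j, ~~ (a j && a (j + 1))) ->
  exists i, (forall j, j != i -> ~~ a j) \/ (forall j, a j = adj C5 i j).
Proof.
move=> N; case: (pickP a) => [j aj|h]; last by exists 0; left=> j _; rewrite h.
pose b e := a (j + e); have b0 : b 0 by rewrite /b addr0.
have Nb e : ~~ (b e && b (e + 1)) by rewrite /b addrA.
suff [i [h|h]] : exists i, (forall e, e != i -> ~~ b e) \/ (forall e, b e = adj C5 i e).
- exists (j + i); left=> k ki; have := h (k - j); rewrite /b subrKC; apply.
  by rewrite subr_eq addrC.
- by exists (j + i); right=> k; rewrite -[k in LHS](subrKC j) [LHS]h -(adj_C5_shift j) subrKC.
have n4 : b (1 + 1 + 1 + 1) = false.
  by have := Nb (1 + 1 + 1 + 1); rewrite (_ : 1 + 1 + 1 + 1 + 1 = 0) ?b0 ?andbT => [/negbTE|]; last exact: val_inj.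
have n1 : b 1 = false by have := Nb 0; rewrite b0 add0r => /negbTE.
have := Nb (1 + 1).
case b2 : (b (1 + 1)); case b3 : (b (1 + 1 + 1)) => // _.
- exists 1; right=> e; apply/eqP; move: e; apply: all_I5.
  by rewrite b0 n1 b2 b3 n4 !adj_C5E.
- exists (1 + 1 + 1 + 1); right=> e; apply/eqP; move: e; apply: all_I5.
  by rewrite b0 n1 b2 b3 n4 !adj_C5E.
- exists 0; left=> e; apply/implyP; move: e; apply: all_I5; by rewrite b0 n1 b2 b3 n4.
Qed.
Lemma leq_card_bigcup (I T : finType) (X : I -> {set T}) :
  (#|\bigcup_i X i|%SET <= \sum_i #|X i|)%N.
Proof.
elim/big_rec2: _ => [|i n A _ le_An]; first by rewrite cards0.
by apply: leq_trans (leq_card_setU _ _) _; rewrite leq_add2l.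
Qed.

Section GoodVertices.
Variables (T : finType) (G : sgraph T).
Implicit Types (f : {ffun 'I_5 -> T}) (u v x y : T) (i j : 'I_5).

Definition good f i v : bool := [forall j, adj G v (f j) == adj C5 i j].

Definition bad f v : bool := ~~ [exists i, good f i v].

Definition missing f u v : bool :=
  [exists i, good f i u && good f (i + 1) v] && ~~ adj G u v.

(** The pairs are ordered: a bad vertex [v] enters with all [#|T|] pairs [(v, u)], which pay for
    every edit at [v]. *)
Definition faults f : {set T * T} :=
  [set p | bad f p.1 || missing f p.1 p.2].

Definition tuple5 (a b c d e : T) : {ffun 'I_5 -> T} :=
  [ffun j : 'I_5 => nth e [:: a; b; c; d] j].

Lemma ffun_mat_tuple5 a b c d e k l : (k < 5)%N -> (l < 5)%N ->
  ffun_mat G (tuple5 a b c d e) k l =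
  adj G (nth e [:: a; b; c; d] k) (nth e [:: a; b; c; d] l).
Proof. by move=> hk hl; rewrite /ffun_mat !ffunE !inordK. Qed.

(* If v sees at most f i on the pentagon f, then the other four vertices of f
   and v span P4 + K1. *)
Definition bad_tuple i f v : {ffun 'I_5 -> T} :=
  tuple5 (f (i + 1)) (f (i + 1 + 1)) (f (i + 1 + 1 + 1)) (f (i + 1 + 1 + 1 + 1)) v.

(* If u and v are good of classes i and i + 1 but not adjacent, then u and v are
   the ends of an induced P5 through f (i - 1), f (i - 2), f (i - 3). *)
Definition missing_tuple i f u v : {ffun 'I_5 -> T} :=
  tuple5 u (f (i + 1 + 1 + 1 + 1)) (f (i + 1 + 1 + 1)) (f (i + 1 + 1)) v.

Hypothesis tf : triangle_free G.

(** Triangle-freeness makes the trace of [v] on the pentagon independent. It is not a neighbourhood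
    in [C5], since [v] is bad, so it has at most one element. *)
Lemma bad_defect f v : f \in pentagons G -> bad f v ->
  exists i, bad_tuple i f v \in defects G.
Proof.
move=> /pentagonsP pf bv.
have D i : (forall j, j != i -> ~~ adj G v (f j)) -> bad_tuple i f v \in defects G.
  move=> hi; rewrite inE; apply/orP; right.
  have hi' j : j != i -> adj G (f j) v = false by move=> /hi; rewrite adj_sym => /negbTE.
  have ne d : d != 0 -> i + d != i by rewrite -{2}[i]addr0 (inj_eq (addrI i)).
  rewrite /is_P4K1 /bad_tuple !ffun_mat_tuple5 //= !pf.
  rewrite -!addrA.
  rewrite !hi' ?ne //.
  by rewrite !adj_C5_shift !adj_C5E.
have [j|i [h|h]] := @C5_independent (fun j => adj G v (f j)).
- by have := tf v (f j) (f (j + 1)); rewrite pf adj_C5E eqxx andbCA andTb.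
- by exists i; apply: D.
- by case/existsP: bv; exists i; apply/forallP => j; rewrite h.
Qed.

Lemma missing_defect f u v : f \in pentagons G -> missing f u v ->
  exists i, missing_tuple i f u v \in defects G.
Proof.
move=> /pentagonsP pf /andP[/existsP[i /andP[/forallP gu /forallP gv]] uv].
exists i; rewrite inE; apply/orP; left.
have gu' j : adj G u (f j) = adj C5 (i + 0) j by rewrite addr0; apply/eqP.
have gv' j : adj G (f j) v = adj C5 j (i + 1) by rewrite adj_sym [RHS]adj_sym; apply/eqP.
rewrite /is_P5 /missing_tuple !ffun_mat_tuple5 //= uv !pf !gu' !gv'.
by rewrite -!addrA !adj_C5_shift !adj_C5E.
Qed.

(** The tuple records [v] and four vertices of [f]; the lost [f i] and the free second vertex of the
    pair cost [#|T| ^ 2]. *)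
Lemma card_bad_pairs i :
  (#|[set q : {ffun 'I_5 -> T} * (T * T) | bad_tuple i q.1 q.2.1 \in defects G]|
   <= #|defects G| * #|T| ^ 2)%N.
Proof.
pose h (q : {ffun 'I_5 -> T} * (T * T)) := (bad_tuple i q.1 q.2.1, (q.1 i, q.2.2)).
rewrite -mulnn -!cardsT -!cardsX -(card_imset _ (f := h)).
  by apply/subset_leq_card/fintype.subsetP => _ /imsetP[q + ->]; rewrite !inE /= => ->.
move=> [f [u v]] [f' [u' v']] [/ffunP e ei ->]; congr (_, (_, _)).
- apply/ffunP => k; rewrite -(subrKC i k); move: (k - i); clear k => k.
  apply/eqP; move: k; apply: all_I5; rewrite addr0 ei eqxx /= !addrA.
  have := e (inord 0); have := e (inord 1); have := e (inord 2); have := e (inord 3).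
  by rewrite !ffunE !inordK //= => -> -> -> ->; rewrite !eqxx.
- by have := e (inord 4); rewrite !ffunE !inordK.
Qed.

(** Here the tuple records [u], [v] and three vertices of [f], losing only [f i] and [f (i + 1)]. *)
Lemma card_missing_pairs i :
  (#|[set q : {ffun 'I_5 -> T} * (T * T) |
      missing_tuple i q.1 q.2.1 q.2.2 \in defects G]| <= #|defects G| * #|T| ^ 2)%N.
Proof.
pose h (q : {ffun 'I_5 -> T} * (T * T)) :=
  (missing_tuple i q.1 q.2.1 q.2.2, (q.1 i, q.1 (i + 1))).
rewrite -mulnn -!cardsT -!cardsX -(card_imset _ (f := h)).
  by apply/subset_leq_card/fintype.subsetP => _ /imsetP[q + ->]; rewrite !inE /= => ->.
move=> [f [u v]] [f' [u' v']] [/ffunP e ei ei1]; congr (_, (_, _)).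
- apply/ffunP => k; rewrite -(subrKC i k); move: (k - i); clear k => k.
  apply/eqP; move: k; apply: all_I5; rewrite addr0 ei ei1 !eqxx /= !addrA.
  have := e (inord 1); have := e (inord 2); have := e (inord 3).
  by rewrite !ffunE !inordK //= => -> -> ->; rewrite !eqxx.
- by have := e (inord 0); rewrite !ffunE !inordK.
- by have := e (inord 4); rewrite !ffunE !inordK.
Qed.

(** The factor 10 is five choices of [i] for each of the two kinds of fault. *)
Lemma sum_card_faults :
  (\sum_(f in pentagons G) #|faults f| <= 10 * #|T| ^ 2 * #|defects G|)%N.
Proof.
pose Q : finType := ({ffun 'I_5 -> T} * (T * T))%type.
pose X i := [set q : Q | bad_tuple i q.1 q.2.1 \in defects G].
pose Y i := [set q : Q | missing_tuple i q.1 q.2.1 q.2.2 \in defects G].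
have -> : (\sum_(f in pentagons G) #|faults f| =
    #|[set q : Q | (q.1 \in pentagons G) && (q.2 \in faults q.1)]|)%N.
  rewrite -sum1_card; under eq_bigr do rewrite -sum1_card.
  by rewrite pair_big_dep; apply: eq_bigl => q; rewrite inE.
apply: (@leq_trans #|\bigcup_i (X i :|: Y i)|%SET).
  apply/subset_leq_card/fintype.subsetP => -[f [u v]]; rewrite inE /= => /andP[pf].
  rewrite inE /= => /orP[/(bad_defect pf)|/(missing_defect pf)] [i hi];
    by apply/bigcupP; exists i; rewrite // finset.in_setU [_ \in X i]finset.in_set [_ \in Y i]finset.in_set /= hi ?orbT.
apply: leq_trans (leq_card_bigcup _) _.
apply: (@leq_trans (\sum_(i : 'I_5) (2 * (#|T| ^ 2 * #|defects G|))%N)).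
  apply: leq_sum => i _; apply: leq_trans (leq_card_setU _ _) _.
  by rewrite mul2n -addnn [(#|T| ^ 2 * _)%N]mulnC leq_add ?card_bad_pairs ?card_missing_pairs.
by rewrite sum_nat_const card_ord !mulnA.
Qed.

Lemma exists_pentagon_few_faults : (0 < #|pentagons G|)%N ->
  exists2 f, f \in pentagons G &
    (#|pentagons G| * #|faults f| <= 10 * #|T| ^ 2 * #|defects G|)%N.
Proof.
case/card_gt0P => f0 pf0; case: (arg_minnP (fun f => #|faults f|) pf0) => f pf minf.
exists f => //; apply: leq_trans sum_card_faults; rewrite -sum_nat_const.
exact: leq_sum.
Qed.

(** The default class of a bad vertex is harmless, since every edit at such a vertex is already
    charged to a fault. *)
Definition class_of f v : 'I_5 := odflt ord0 [pick i | good f i v].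

Lemma good_class_of f v : ~~ bad f v -> good f (class_of f v) v.
Proof.
rewrite negbK => /existsP[i gi]; rewrite /class_of.
by case: pickP => // /(_ i); rewrite gi.
Qed.

(** Otherwise [i] and [j] have a common neighbour [k] in [C5], and [f k] completes a triangle with
    [u] and [v]. *)
Lemma good_triangle f i j u v : f \in pentagons G -> good f i u -> good f j v ->
  adj G u v -> adj C5 i j.
Proof.
move=> /pentagonsP pf /forallP gu /forallP gv uv.
have N k : ~~ (adj C5 i k && adj C5 j k).
  apply/negP => /andP[ik jk]; have := tf u v (f k).
  by rewrite uv (eqP (gu k)) (eqP (gv k)) ik jk.
have [//|/C5_common_neighbor[k]] := boolP (adj C5 i j).
by rewrite (negbTE (N k)).
Qed.

(** A pair on which the two graphs differ has a bad end or is an edge missing between consecutive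
    classes; [good_triangle] excludes surplus edges. *)
Lemma edit_count_le f : f \in pentagons G ->
  (edit_count G (blowup C5 (class_of f)) <= #|faults f|)%N.
Proof.
move=> pf; set H := blowup _ _.
apply: (@leq_trans #|[set [set p.1; p.2]%SET | p in faults f]|%N); last exact: leq_imset_card.
apply/subset_leq_card/fintype.subsetP => e.
have D x y : adj G x y != adj H x y -> [set x; y]%SET \in [set [set p.1; p.2]%SET | p in faults f].
  rewrite adj_of_rel => d.
  have [bx|gx] := boolP (bad f x); first by apply/imsetP; exists (x, y); rewrite // inE /= bx.
  have [by_|gy] := boolP (bad f y).
    by apply/imsetP; exists (y, x); [rewrite inE /= by_ | rewrite finset.setUC].
  have {}gx := good_class_of gx; have {}gy := good_class_of gy.
  move: d; case xy: (adj G x y) => /=.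
    by rewrite (good_triangle pf gx gy xy).
  rewrite negbK adj_C5E => /orP[/eqP c|/eqP c].
    apply/imsetP; exists (x, y); rewrite // inE /= /missing xy andbT.
    by apply/orP; right; apply/existsP; exists (class_of f x); rewrite gx -c gy.
  apply/imsetP; exists (y, x); last by rewrite finset.setUC.
  rewrite inE /= /missing adj_sym xy andbT.
  by apply/orP; right; apply/existsP; exists (class_of f y); rewrite gy -c gx.
rewrite !inE => /orP[]/andP[nE /imsetP[[x y]]]; rewrite inE /= => xy eE; rewrite eE in nE *;
  apply: D; apply: contra nE => /eqP E; apply/imsetP; exists (x, y); rewrite // inE /=.
- by rewrite -E.
- by rewrite E.
Qed.

End GoodVertices.

(** * Counting pentagons in blow-ups *)

Lemma isoP (S T : finType) (F : sgraph S) (G : sgraph T) :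
  reflect (exists2 f : S -> T, bijective f & forall x y, adj G (f x) (f y) = adj F x y)
          (iso F G).
Proof.
apply: (iffP existsP) => [[f /and3P[/injectiveP fi /forallP fs /forallP fa]]|[f fb fa]].
  exists f => [|x y]; last by have /forallP/(_ y)/eqP := fa x.
  exists (fun y => iinv (fs y)) => x; last exact: f_iinv.
  by apply: fi; rewrite f_iinv.
exists [ffun x => f x]; apply/and3P; split.
- by apply/injectiveP => x y; rewrite !ffunE; exact: (bij_inj fb).
- apply/forallP => y; case: fb => g _ gK; apply/codomP; exists (g y).
  by rewrite ffunE gK.
- by apply/forallP => x; apply/forallP => y; rewrite !ffunE fa.
Qed.

Lemma iso_sym (S T : finType) (F : sgraph S) (G : sgraph T) : iso F G -> iso G F.
Proof.
case/isoP => f [g fK gK] fa; apply/isoP; exists g; first by exists f.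
by move=> x y; rewrite -fa !gK.
Qed.

Lemma iso_trans (S T U : finType) (F : sgraph S) (G : sgraph T) (H : sgraph U) :
  iso F G -> iso G H -> iso F H.
Proof.
case/isoP => f fb fa /isoP[g gb ga]; apply/isoP; exists (g \o f); first exact: bij_comp.
by move=> x y /=; rewrite ga fa.
Qed.

Lemma iso_inducedP (S T : finType) (F : sgraph S) (G : sgraph T) (A : {set T}) :
  reflect (exists f : {ffun S -> T}, [/\ injective f,
             (forall x y, adj G (f x) (f y) = adj F x y) & f @: [set: S]%SET = A])
          (iso F (Defs.induced G A)).
Proof.
apply: (iffP (isoP F (Defs.induced G A))) => [[f [g fK gK] fa]|[f [fi fa fA]]].
  exists [ffun x => val (f x)]; split=> [x y|x y|].
  - by rewrite !ffunE => /val_inj/(can_inj fK).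
  - by rewrite !ffunE -fa adj_of_rel.
  - apply/setP => v; apply/imsetP/idP => [[x _ ->]|vA]; first by rewrite ffunE; exact: valP.
    by exists (g (Sub v vA)); rewrite ?inE // ffunE gK.
have fIn x : f x \in A by rewrite -fA imset_f ?inE.
exists (fun x => Sub (f x) (fIn x)) => [|x y]; last by rewrite adj_of_rel /= fa.
have im u : u \in A -> u \in [seq f x | x in S].
  by rewrite -fA => /imsetP[x _ ->]; exact: codom_f.
have h (v : {x | x \in A}) : val v \in [seq f x | x in S].
  by apply: im; exact: valP.
exists (fun v => iinv (h v)) => [x|v]; last by apply: val_inj; rewrite /= f_iinv.
by apply: fi; rewrite f_iinv.
Qed.

Lemma triangle_free_admissible (T : finType) (G : sgraph T) :
  triangle_free G <-> admissible triangle_family G.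
Proof.
split=> [tf _ -> [A /iso_inducedP[/= f [_ fa _]]]|ad x y z].
  have := tf (f (inord 0)) (f (inord 1)) (f (inord 2)).
  by rewrite !fa !adj_of_rel /= -!val_eqE /= !inordK.
apply/negP => /and3P[xy yz xz].
have := ad _ erefl; apply; exists [set x; y; z]%SET; apply/iso_inducedP => /=.
have neq u v : adj G u v -> u != v by apply: contraTneq => ->; rewrite adj_irr.
exists [ffun i : 'I_3 => nth z [:: x; y] i]; split.
- move=> [[|[|[|//]]] hi] [[|[|[|//]]] hj]; rewrite !ffunE /= => e;
  apply: val_inj => //=; move: xy yz xz => /neq/eqP xy /neq/eqP yz /neq/eqP xz; by congruence.
- move=> [[|[|[|//]]] hi] [[|[|[|//]]] hj]; rewrite !ffunE adj_of_rel /= ?adj_irr ?xy ?yz ?xz //;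
  by rewrite adj_sym ?xy ?yz ?xz.
- apply/setP => v; rewrite !inE; apply/imsetP/idP => [[[[|[|[|//]]] hi] _ ->]|].
  + by rewrite ffunE eqxx.
  + by rewrite ffunE eqxx orbT.
  + by rewrite ffunE eqxx orbT.
  + by case/orP => [/orP[]|] /eqP->; [exists (inord 0)|exists (inord 1)|exists (inord 2)];
      rewrite ?inE // ffunE inordK.
Qed.

Lemma triangle_free_C5 : triangle_free C5.
Proof.
move=> x y z; rewrite !adj_of_rel.
by case: x y z => [[|[|[|[|[|//]]]]] hx] [[|[|[|[|[|//]]]]] hy] [[|[|[|[|[|//]]]]] hz].
Qed.

Lemma triangle_free_blowup (S T : finType) (B : sgraph S) (c : T -> S) :
  triangle_free B -> triangle_free (blowup B c).
Proof. by move=> tf x y z; rewrite !adj_of_rel. Qed.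

(** No two vertices of [C5] have the same neighbourhood: 0 is the only common neighbour of 1 and
    4. *)
Lemma pentagon_inj (T : finType) (G : sgraph T) f : f \in pentagons G -> injective f.
Proof.
move=> /pentagonsP pf i j eij.
have h k : adj C5 i k = adj C5 j k by rewrite -!pf eij.
have : [|| j - i == 0, adj C5 (j - i) 1 != adj C5 0 1 |
    adj C5 (j - i) (1 + 1 + 1 + 1) != adj C5 0 (1 + 1 + 1 + 1)].
  by move: (j - i); apply: all_I5; rewrite !adj_C5E.
have hs k : adj C5 (j - i) k = adj C5 0 k.
  by rewrite -(adj_C5_shift i) subrKC -h -{1}[i]addr0 adj_C5_shift.
by rewrite !hs !eqxx !orbF subr_eq0 => /eqP.
Qed.

Lemma mem_pentagon_image (T : finType) (G : sgraph T) (A : {set T}) :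
  ((#|A| == #|'I_5|) && iso C5 (Defs.induced G A)) =
  (A \in [set f @: [set: 'I_5]%SET | f : {ffun 'I_5 -> T} in pentagons G]%SET).
Proof.
apply/andP/imsetP => [[_ /iso_inducedP[f [_ fa <-]]]|[f pf ->]].
  by exists f => //; apply/pentagonsP.
split; first by rewrite card_imset ?cardsT //; exact: pentagon_inj pf.
apply/iso_inducedP; exists f; split=> //; first exact: pentagon_inj pf.
exact/pentagonsP.
Qed.

(** The pentagons with a given image arise from any one of them by composition with the elements of
    [pentagons C5], which are the automorphisms of [C5]. *)
Lemma card_pentagons (T : finType) (G : sgraph T) :
  #|pentagons G| = (#|pentagons C5| * induced_count C5 G)%N.
Proof.
pose im (f : {ffun 'I_5 -> T}) := (f @: [set: 'I_5])%SET.
have -> : induced_count C5 G = #|(im @: pentagons G)%SET|.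
  by apply: eq_card => A; rewrite inE mem_pentagon_image.
rewrite -sum1_card (partition_big_imset im) /= mulnC -sum_nat_const.
apply: eq_bigr => _ /imsetP[g pg ->]; rewrite sum1_card.
pose h (s : {ffun 'I_5 -> 'I_5}) : {ffun 'I_5 -> T} := [ffun i => g (s i)].
have gi := pentagon_inj pg; move/pentagonsP: (pg) => ga.
rewrite -(card_imset _ (f := h)); last first.
  by move=> s t /ffunP e; apply/ffunP => i; have := e i; rewrite !ffunE => /gi.
apply: eq_card => f; rewrite unfold_in /=; apply/andP/imsetP => [[pf /eqP e]|[s ps ->]].
  have im_g i : f i \in codom g.
    have : f i \in im f by rewrite imset_f ?inE.
    by rewrite e => /imsetP[k _ ->]; exact: codom_f.
  exists [ffun i => iinv (im_g i)]; last by apply/ffunP => i; rewrite !ffunE f_iinv.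
  apply/pentagonsP => i j; rewrite !ffunE -[LHS]ga !f_iinv.
  by move/pentagonsP: pf => ->.
split; first by apply/pentagonsP => i j; rewrite !ffunE ga; move/pentagonsP: ps => ->.
rewrite /im; apply/eqP/setP => v; apply/imsetP/imsetP => [[i _ ->]|[i _ ->]].
  by exists (s i); rewrite // ffunE.
have [t _ tK] := injF_bij (pentagon_inj ps).
by exists (t i); rewrite // ffunE tK.
Qed.

Lemma adj_C5_opp (i j : 'I_5) : adj C5 (- i) (- j) = adj C5 i j.
Proof.
rewrite !adj_of_rel /=.
by case: i j => [[|[|[|[|[|//]]]]] hi] [[|[|[|[|[|//]]]]] hj].
Qed.

Lemma card_aut_C5_ge10 : (10 <= #|pentagons C5|)%N.
Proof.
pose h (p : 'I_5 * bool) : {ffun 'I_5 -> 'I_5} :=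
  [ffun i => if p.2 then p.1 + i else p.1 - i].
have <- : #|[set: 'I_5 * bool]%SET| = 10%N by rewrite cardsT card_prod card_ord card_bool.
rewrite -(card_imset _ (f := h)).
  apply/subset_leq_card/fintype.subsetP => _ /imsetP[[k []] _ ->]; apply/pentagonsP => i j;
  rewrite !ffunE /= adj_C5_shift //.
  by rewrite adj_C5_opp.
move=> [k b] [l c] /ffunP e.
have := e 0; rewrite !ffunE /= subr0 addr0 subr0 addr0 !if_same => kl.
have := e 1; rewrite !ffunE /= kl.
by case: b c {e} => [] [] //= /addrI.
Qed.

Lemma card_ffun_fiber (T : finType) (c : T -> 'I_5) (s : {ffun 'I_5 -> 'I_5}) :
  #|[set f : {ffun 'I_5 -> T} | [ffun i => c (f i)] == s]| =
  (\prod_i #|[set v | c v == s i]%SET|)%N.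
Proof.
transitivity #|family (fun i => [pred v | c v == s i])|.
  apply: eq_card => f; rewrite inE; apply/eqP/familyP => [<- i|h].
    by rewrite inE ffunE.
  by apply/ffunP => i; rewrite ffunE; have := h i; rewrite inE => /eqP.
rewrite card_family foldrE big_map big_enum /=.
by apply: eq_bigr => i _; apply: eq_card => v; rewrite !inE.
Qed.

Lemma mem_pentagons_blowup (T : finType) (c : T -> 'I_5) (f : {ffun 'I_5 -> T}) :
  (f \in pentagons (blowup C5 c)) = ([ffun i => c (f i)] \in pentagons C5).
Proof.
apply/pentagonsP/pentagonsP => h i j; have := h i j; rewrite !ffunE.
  by rewrite [adj (blowup _ _) _ _]adj_of_rel.
by rewrite [adj (blowup _ _) _ _]adj_of_rel.
Qed.

(** A map is a pentagon of the blow-up exactly when its composite with [c] is an automorphism of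
    [C5]. All these fibres have the same size, as an automorphism only permutes the factors. *)
Lemma induced_count_blowup (T : finType) (c : T -> 'I_5) :
  induced_count C5 (blowup C5 c) = (\prod_i #|[set v | c v == i]%SET|)%N.
Proof.
have a0 : (0 < #|pentagons C5|)%N by apply: leq_trans card_aut_C5_ge10.
apply/eqP; rewrite -(eqn_pmul2l a0) -card_pentagons; apply/eqP.
rewrite -sum1_card (partition_big (fun f : {ffun 'I_5 -> T} => [ffun i => c (f i)])
  (mem (pentagons C5))) /=; last by move=> f; rewrite mem_pentagons_blowup.
rewrite -sum_nat_const; apply: eq_bigr => s ps.
transitivity #|[set f : {ffun 'I_5 -> T} | [ffun i => c (f i)] == s]|.
  rewrite -sum1_card; apply: eq_bigl => f; rewrite mem_pentagons_blowup [RHS]finset.in_set.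
  by case: eqP => [->|]; rewrite ?andbF // andbT.
rewrite card_ffun_fiber; have [t st ts] := injF_bij (pentagon_inj ps).
by rewrite [RHS](reindex s) //; exists t.
Qed.

Section Lambda_pentagon.
Variables (R : realType) (reps : {set sgraph 'I_5}) (gamma : sgraph 'I_5 -> R).
Hypothesis hreps : iso_representatives triangle_family reps.
Hypothesis hgamma : forall H, H \in reps -> gamma H = if iso H C5 then 1 else 0.

Lemma eq_induced_count (S S' T : finType) (F : sgraph S) (F' : sgraph S') (G : sgraph T) :
  iso F F' -> #|S| = #|S'| -> induced_count F G = induced_count F' G.
Proof.
move=> FF' SS'; apply: eq_card => A; rewrite !inE SS'; congr (_ && _).
by apply/idP/idP; apply: iso_trans => //; exact: iso_sym.
Qed.

(** Exactly one representative is isomorphic to [C5]; it exists because [C5] is triangle-free. *)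
Lemma LambdaE (T : finType) (G : sgraph T) :
  Lambda reps gamma G = (induced_count C5 G)%:R.
Proof.
have [_ reps_ex reps_uniq] := hreps.
have [H0 H0r isoH0] := reps_ex C5 ((triangle_free_admissible C5).1 triangle_free_C5).
rewrite /Lambda (bigD1 H0) //= hgamma // (iso_sym isoH0) mul1r big1 ?addr0.
  by congr (_%:R); apply: eq_induced_count; first exact: iso_sym.
move=> H /andP[Hr neqH]; rewrite hgamma //; case: ifP => [isoH|_]; last by rewrite mul0r.
by case/eqP: neqH; apply: reps_uniq => //; apply: iso_trans isoH isoH0.
Qed.

(** A crude bound, which makes the set in the supremum [Lambda_max] bounded. *)
Lemma induced_count_le (T : finType) (G : sgraph T) : (induced_count C5 G <= #|T| ^ 5)%N.
Proof.
apply: (@leq_trans #|pentagons G|); last by rewrite (leq_trans (max_card _)) ?card_ffun ?card_ord.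
by rewrite card_pentagons leq_pmull // (leq_trans _ card_aut_C5_ge10).
Qed.

Lemma Lambda_max_ge (T : finType) (G : sgraph T) : triangle_free G ->
  (induced_count C5 G)%:R <= Lambda_max triangle_family reps gamma #|T|.
Proof.
move=> tf; apply: ub_le_sup.
  exists (#|T| ^ 5)%:R => _ [T' [G' [<- _ ->]]].
  by rewrite LambdaE ler_nat induced_count_le.
exists T, G; split => //; last by rewrite LambdaE.
exact/triangle_free_admissible.
Qed.

End Lambda_pentagon.

Lemma card_residue5 n (i : 'I_5) :
  #|[set v : 'I_n | inord (v %% 5) == i]%SET| = ((n + 4 - i) %/ 5)%N.
Proof.
have -> : #|[set v : 'I_n | inord (v %% 5) == i]%SET| = (\sum_(v < n) (v %% 5 == i))%N.
  rewrite -sum1_card big_mkcond /=; apply: eq_bigr => v _.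
  by rewrite inE -val_eqE /= inordK ?ltn_mod //; case: (_ == _).
elim: n => [|n IH]; first by rewrite big_ord0 divn_small // ltn_subLR; have := ltn_ord i; lia.
by rewrite big_ord_recr /= IH; have := ltn_ord i; lia.
Qed.

(** For $n = 5q + r$ both fifth-degree terms expand as $5^5(q^5 + r q^4)$ plus lower order. For each
    $r$ the slack is an explicit polynomial in $q$ with nonnegative coefficients. *)
Lemma balanced_parts_product n :
  (n ^ 5 <= 5 ^ 5 * \prod_(i < 5) ((n + 4 - i) %/ 5) + 17 * n ^ 3)%N.
Proof.
rewrite !big_ord_recl big_ord0 /= /bump /= muln1.
rewrite (divn_eq n 5); move: (n %/ 5)%N (n %% 5)%N (ltn_mod n 5) => q.
case=> [|[|[|[|[|//]]]]] _.
- have -> : ((q * 5 + 0 + 4 - 0) %/ 5 = q)%N by lia.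
  have -> : ((q * 5 + 0 + 4 - 1) %/ 5 = q)%N by lia.
  have -> : ((q * 5 + 0 + 4 - 2) %/ 5 = q)%N by lia.
  have -> : ((q * 5 + 0 + 4 - 3) %/ 5 = q)%N by lia.
  have -> : ((q * 5 + 0 + 4 - 4) %/ 5 = q)%N by lia.
  by apply: leq_trans (leq_addr (2125 * q ^ 3) _) _; apply/eq_leq; ring.
- have -> : ((q * 5 + 1 + 4 - 0) %/ 5 = q.+1)%N by lia.
  have -> : ((q * 5 + 1 + 4 - 1) %/ 5 = q)%N by lia.
  have -> : ((q * 5 + 1 + 4 - 2) %/ 5 = q)%N by lia.
  have -> : ((q * 5 + 1 + 4 - 3) %/ 5 = q)%N by lia.
  have -> : ((q * 5 + 1 + 4 - 4) %/ 5 = q)%N by lia.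
  by apply: leq_trans (leq_addr (16 * q ^ 0 + 230 * q ^ 1 + 1025 * q ^ 2 + 875 * q ^ 3) _) _; apply/eq_leq; ring.
- have -> : ((q * 5 + 2 + 4 - 0) %/ 5 = q.+1)%N by lia.
  have -> : ((q * 5 + 2 + 4 - 1) %/ 5 = q.+1)%N by lia.
  have -> : ((q * 5 + 2 + 4 - 2) %/ 5 = q)%N by lia.
  have -> : ((q * 5 + 2 + 4 - 3) %/ 5 = q)%N by lia.
  have -> : ((q * 5 + 2 + 4 - 4) %/ 5 = q)%N by lia.
  by apply: leq_trans (leq_addr (104 * q ^ 0 + 620 * q ^ 1 + 550 * q ^ 2 + 250 * q ^ 3) _) _; apply/eq_leq; ring.
- have -> : ((q * 5 + 3 + 4 - 0) %/ 5 = q.+1)%N by lia.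
  have -> : ((q * 5 + 3 + 4 - 1) %/ 5 = q.+1)%N by lia.
  have -> : ((q * 5 + 3 + 4 - 2) %/ 5 = q.+1)%N by lia.
  have -> : ((q * 5 + 3 + 4 - 3) %/ 5 = q)%N by lia.
  have -> : ((q * 5 + 3 + 4 - 4) %/ 5 = q)%N by lia.
  by apply: leq_trans (leq_addr (216 * q ^ 0 + 270 * q ^ 1 + 200 * q ^ 2 + 250 * q ^ 3) _) _; apply/eq_leq; ring.
- have -> : ((q * 5 + 4 + 4 - 0) %/ 5 = q.+1)%N by lia.
  have -> : ((q * 5 + 4 + 4 - 1) %/ 5 = q.+1)%N by lia.
  have -> : ((q * 5 + 4 + 4 - 2) %/ 5 = q.+1)%N by lia.
  have -> : ((q * 5 + 4 + 4 - 3) %/ 5 = q.+1)%N by lia.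
  have -> : ((q * 5 + 4 + 4 - 4) %/ 5 = q)%N by lia.
  by apply: leq_trans (leq_addr (64 * q ^ 0 + 805 * q ^ 1 + 1600 * q ^ 2 + 875 * q ^ 3) _) _; apply/eq_leq; ring.
Qed.

(** Nonadjacent vertices of [C5] have a common neighbour, so an extra edge of [H] inside a pentagon
    of [G] would close a triangle. *)
Lemma pentagons_subset (T : finType) (G H : sgraph T) :
  (forall x y, adj G x y -> adj H x y) -> triangle_free H ->
  pentagons G \subset pentagons H.
Proof.
move=> GH tf; apply/fintype.subsetP => f /pentagonsP pf; apply/pentagonsP => i j.
have E k l : adj C5 k l -> adj H (f k) (f l) by rewrite -pf; exact: GH.
have [/E//|/C5_common_neighbor[k /andP[ik jk]]] := boolP (adj C5 i j).
apply/negP => h; have := tf (f i) (f j) (f k).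
by rewrite h !E.
Qed.

(** The upper bound is the pentagon inequality for [C5] itself: $625\,a \le 2 \cdot 5^5 = 625 \cdot
    10$. *)
Lemma card_aut_C5 : #|pentagons C5| = 10%N.
Proof.
apply/eqP; rewrite eqn_leq card_aut_C5_ge10 andbT.
have := pentagon_inequality triangle_free_C5; rewrite card_ord => h.
have : (625 * #|pentagons C5| <= 625 * 10)%N by apply: leq_trans h; exact: leq_addr.
by rewrite leq_pmul2l.
Qed.

Lemma C5_edge_aut (i j : 'I_5) : adj C5 i j ->
  exists2 s, s \in pentagons C5 & s 0 = i /\ s 1 = j.
Proof.
rewrite adj_C5E => /orP[/eqP->|/eqP->].
  exists [ffun k => i + k]; last by rewrite !ffunE addr0.
  by apply/pentagonsP => k l; rewrite !ffunE adj_C5_shift.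
exists [ffun k => j + 1 - k]; last by rewrite !ffunE subr0 addrK.
by apply/pentagonsP => k l; rewrite !ffunE adj_C5_shift adj_C5_opp.
Qed.

(** Labels 0 and 1 are fixed at [u] and [v]. An automorphism [s] matching their classes lets each of
    the other three labels range freely over one part. *)
Lemma pentagons_through_edge (T : finType) (c : T -> 'I_5) (m : nat) (u v : T)
    (H := blowup C5 c) :
  (forall i, (m <= #|[set w | c w == i]%SET|)%N) -> adj H u v ->
  (m ^ 3 <= #|[set g in pentagons H | (g 0%R == u) && (g 1%R == v)]%SET|)%N.
Proof.
move=> hm; rewrite adj_of_rel => /C5_edge_aut[s ps [s0 s1]].
pose F (k : 'I_5) := if k == 0 then pred1 u else if k == 1 then pred1 v
  else [pred w | c w == s k].
apply: (@leq_trans #|family F|).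
  rewrite card_family foldrE big_map big_enum /= !big_ord_recl big_ord0 /F /=.
  have h k : (m <= #|[pred w | c w == s k]|)%N.
    by apply: leq_trans (hm (s k)) _; apply/eq_leq/eq_card => w; rewrite !inE.
  rewrite !card1 !mul1n muln1 expnS expnS expn1.
  by rewrite !leq_mul ?h.
apply/subset_leq_card/fintype.subsetP => g /familyP hg.
have g0 : g 0 = u by apply/eqP; exact: (hg 0).
have g1 : g 1 = v by apply/eqP; exact: (hg 1).
rewrite finset.in_set g0 g1 !eqxx andbT mem_pentagons_blowup.
suff -> : [ffun i => c (g i)] = s by rewrite ps.
apply/ffunP => i; rewrite ffunE; have := hg i; rewrite /F.
case: eqP => [->|_]; first by rewrite g0 s0.
by case: eqP => [->|_]; [rewrite g1 s1 | move/eqP].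
Qed.

(** A missing pair destroys the labelled pentagons that have it at labels 0 and 1, and distinct
    ordered pairs destroy disjoint families. The factor 10 counts labellings. *)
Lemma card_missing_edges_le (T : finType) (G : sgraph T) (c : T -> 'I_5) (m : nat)
    (H := blowup C5 c) :
  (forall x y, adj G x y -> adj H x y) ->
  (forall i, (m <= #|[set w | c w == i]%SET|)%N) ->
  (#|[set p : T * T | adj H p.1 p.2 && ~~ adj G p.1 p.2]%SET| * m ^ 3
   <= 10 * (induced_count C5 H - induced_count C5 G))%N.
Proof.
move=> GH hm; have tfH : triangle_free H by apply: triangle_free_blowup triangle_free_C5.
rewrite mulnBr -card_aut_C5 -!card_pentagons.
rewrite -(finset.setIidPr (pentagons_subset GH tfH)) -finset.cardsD.
set M := [set p | _]; set D := pentagons H :\: pentagons G.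
apply: (@leq_trans (\sum_(p in M) #|[set g in D | (g 0%R, g 1%R) == p]%SET|)).
  rewrite -sum_nat_const; apply: leq_sum => -[u v]; rewrite inE /= => /andP[Huv Guv].
  apply: leq_trans (pentagons_through_edge hm Huv) _; apply/subset_leq_card/fintype.subsetP => g.
  rewrite finset.in_set => /andP[pg /andP[/eqP g0 /eqP g1]].
  rewrite finset.in_set finset.in_setD pg andbT g0 g1 eqxx andbT.
  by apply: contra Guv => /pentagonsP/(_ 0 1); rewrite g0 g1 adj_C5E => ->.
rewrite -[leqRHS]sum1_card (partition_big (fun g : {ffun 'I_5 -> T} => (g 0%R, g 1%R)) predT) //=.
rewrite big_mkcond /=; apply: leq_sum => p _; case: ifP => // _.
by rewrite -sum1_card; apply/eq_leq/eq_bigl => g; rewrite finset.in_set.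
Qed.

(** * Perfect stability *)

Section NoBadVertex.
Variables (T : finType) (G : sgraph T) (f : {ffun 'I_5 -> T}).
Hypotheses (tf : triangle_free G) (pf : f \in pentagons G).
Hypothesis no_bad : forall v, ~~ bad G f v.
Let c := class_of G f.
Let H := blowup C5 c.

Lemma no_bad_subgraph x y : adj G x y -> adj H x y.
Proof.
rewrite [adj H _ _]adj_of_rel.
exact: good_triangle (good_class_of (no_bad x)) (good_class_of (no_bad y)).
Qed.

Lemma no_bad_faults :
  faults G f \subset [set p : T * T | adj H p.1 p.2 && ~~ adj G p.1 p.2]%SET.
Proof.
have E i x j : good G f i x -> adj C5 (c x) j = adj C5 i j.
  move=> /forallP gx; rewrite -(eqP (gx j)).
  by have /forallP/(_ j)/eqP -> := good_class_of (no_bad x).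
apply/fintype.subsetP => -[x y]; rewrite inE /= (negbTE (no_bad x)) /=.
move=> /andP[/existsP[i /andP[gx gy]] nxy]; rewrite inE /= nxy andbT.
by rewrite [adj H _ _]adj_of_rel (E _ _ _ gx) adj_sym (E _ _ _ gy) adj_C5E eqxx orbT.
Qed.

Lemma no_bad_faults_le K : (0 < #|T|)%N -> (#|T| ^ 5 <= K * induced_count C5 G)%N ->
  (#|faults G f| * #|T| ^ 3 <=
   10 * K ^ 3 * (induced_count C5 H - induced_count C5 G))%N.
Proof.
move=> n0 hK.
have K0 : (0 < K)%N.
  by case: K hK => //; rewrite mul0n leqn0 expn_eq0 /= (gtn_eqF n0).
pose s i := #|[set w | c w == i]%SET|.
have [i _ min_i] := arg_minnP (P := predT) s (erefl : predT (0 : 'I_5)).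
(* The pentagons of [H] number at most its smallest part times $n^4$, so $n^5 \le K s_i n^4$. *)
have hs : (#|T| <= K * s i)%N.
  rewrite -(leq_pmul2r (_ : 0 < #|T| ^ 4)%N) ?expn_gt0 ?n0 // -expnS.
  apply: leq_trans hK _; rewrite -mulnA leq_pmul2l //.
  apply: (@leq_trans (induced_count C5 H)).
    have tfH : triangle_free H by apply: triangle_free_blowup triangle_free_C5.
    rewrite -(leq_pmul2l (isT : 0 < 10)%N) -card_aut_C5 -!card_pentagons.
    exact: subset_leq_card (pentagons_subset no_bad_subgraph tfH).
  rewrite induced_count_blowup (bigD1 i) //= leq_mul2l; apply/orP; right.
  apply: (@leq_trans (\prod_(j < 5 | j != i) #|T|)); first by apply: leq_prod => j _; exact: max_card.
  rewrite prod_nat_const; apply/eq_leq; congr (_ ^ _)%N.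
  by have := cardC1 i; rewrite card_ord.
apply: (@leq_trans (#|faults G f| * (K * s i) ^ 3)).
  by rewrite leq_mul2l leq_exp2r ?hs ?orbT.
rewrite expnMn mulnCA [(10 * _)%N]mulnC -mulnA leq_mul2l; apply/orP; right.
apply: leq_trans (card_missing_edges_le no_bad_subgraph (m := s i) _); last by move=> j; exact: min_i.
by rewrite leq_mul2r subset_leq_card ?orbT // no_bad_faults.
Qed.

End NoBadVertex.

Lemma bigminn_le (I : eqType) (r : seq I) (P : pred I) (F : I -> nat) x j :
  j \in r -> P j -> (\big[minn/x]_(i <- r | P i) F i <= F j)%N.
Proof.
elim: r => // i r IH; rewrite inE big_cons => /orP[/eqP<- ->|jr Pj]; first exact: geq_minl.
by case: ifP => _; last exact: IH; apply: leq_trans (geq_minr _ _) (IH jr Pj).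
Qed.

Lemma bigminn_le_default (I : eqType) (r : seq I) (P : pred I) (F : I -> nat) x :
  (\big[minn/x]_(i <- r | P i) F i <= x)%N.
Proof. by elim/big_rec: _ => // i n _ h; apply: leq_trans (geq_minr _ _) h. Qed.

Definition min_edit (T : finType) (G : sgraph T) : nat :=
  \big[minn/'C(#|T|, 2)]_(H : sgraph T | is_blowup C5 H) edit_count G H.

Lemma min_edit_le_class (T : finType) (G : sgraph T) (c : T -> 'I_5) :
  (min_edit G <= edit_count G (blowup C5 c))%N.
Proof.
apply: bigminn_le; first exact: mem_index_enum.
apply/existsP; exists [ffun v => c v]; apply/eqP/val_inj/ffunP => -[x y].
by rewrite /= !ffunE /= ?ffunE.
Qed.

Lemma bin_le_expn n k : ('C(n, k) <= n ^ k)%N.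
Proof.
apply: (@leq_trans (n ^_ k)); first by rewrite -bin_ffact leq_pmulr ?fact_gt0.
elim: k => [|k IH]; first by rewrite ffactn0.
by rewrite ffactnSr expnSr leq_mul // leq_subr.
Qed.

Lemma faults_ge_card (T : finType) (G : sgraph T) f v : bad G f v -> (#|T| <= #|faults G f|)%N.
Proof.
move=> bv; rewrite -cardsT -(card_imset _ (f := fun w => (v, w))); last by move=> ? ? [].
by apply/subset_leq_card/fintype.subsetP => _ /imsetP[w _ ->]; rewrite inE bv.
Qed.

(* In the next two lemmas n is the order of G, q = 5^5, M = Lambda_max n and p is
   the number of pentagons of G; E and D bound the edit distance from above. *)
Lemma few_pentagons_arith (R : realFieldType) (q n M p E : R) :
  1 <= q -> 68 * q <= n -> n ^+ 5 <= q * M + 17 * n ^+ 3 -> 2 * q * p <= n ^+ 5 ->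
  E <= n ^+ 2 -> n ^+ 3 * E <= 80 * q ^+ 3 * (M - p).
Proof.
move=> q1 nq hM hp hE.
have n68 : 68 <= n by lra.
have n3 : 0 <= n ^+ 3 by rewrite exprn_ge0 //; lra.
have h1 : n ^+ 3 * E <= n ^+ 5.
  have -> : n ^+ 5 = n ^+ 3 * n ^+ 2 by ring.
  by rewrite ler_wpM2l.
have h2 : 68 * n ^+ 3 <= n ^+ 5.
  have -> : n ^+ 5 = n ^+ 2 * n ^+ 3 by ring.
  rewrite ler_wpM2r // expr2.
  by apply: le_trans (_ : 68 * 1 <= _); [rewrite mulr1|apply: ler_pM; lra].
(* The error term takes at most a quarter of $n^5$ and $qp$ at most a half. *)
have h3 : n ^+ 5 <= 4 * (q * (M - p)) by lra.
apply: le_trans h1 (le_trans h3 _).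
have Mp : 0 <= q * (M - p) by apply: le_trans (_ : n ^+ 5 / 4 <= _); lra.
have q2 : 1 <= q ^+ 2 by rewrite exprn_ege1.
have -> : 80 * q ^+ 3 * (M - p) = (80 * q ^+ 2) * (q * (M - p)) by ring.
by apply: ler_wpM2r => //; lra.
Qed.

Lemma many_faults_arith (R : realFieldType) (q n M p D : R) :
  1 <= q -> 68 * q <= n -> n ^+ 5 <= q * M + 17 * n ^+ 3 ->
  n ^+ 3 * D * 3 <= 4 * q * (n ^+ 5 - q * p) -> n <= D ->
  n ^+ 3 * D <= 80 * q ^+ 3 * (M - p).
Proof.
move=> q1 nq hM hD nD.
have n68 : 68 <= n by lra.
have n3 : 0 <= n ^+ 3 by rewrite exprn_ge0 //; lra.
(* Here $68 = 4 \cdot 17$: multiplied by $4q$, the error term $17n^3$ is at most $n^3 D$ because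
   $68q \le n \le D$, and it is absorbed into the left side of [hD]. *)
have h1 : n ^+ 3 * (68 * q) <= n ^+ 3 * D by rewrite ler_wpM2l //; lra.
have h2 : q * n ^+ 5 <= q * (q * M + 17 * n ^+ 3) by rewrite ler_wpM2l //; lra.
have h3 : n ^+ 3 * D <= 2 * (q ^+ 2 * (M - p)) by lra.
have Mp : 0 <= q ^+ 2 * (M - p).
  have : 0 <= n ^+ 3 * D by rewrite mulr_ge0 //; lra.
  by lra.
have -> : 80 * q ^+ 3 * (M - p) = (80 * q) * (q ^+ 2 * (M - p)) by ring.
apply: le_trans h3 _; apply: ler_wpM2r => //; lra.
Qed.

Section Stability.
Variables (R : realType) (reps : {set sgraph 'I_5}) (gamma : sgraph 'I_5 -> R).
Hypothesis hreps : iso_representatives triangle_family reps.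
Hypothesis hgamma : forall H, H \in reps -> gamma H = if iso H C5 then 1 else 0.

Let M n := Lambda_max triangle_family reps gamma n.
Let q : R := 5 ^+ 5.

Lemma Lambda_max_balanced n : n%:R ^+ 5 <= q * M n + 17 * n%:R ^+ 3.
Proof.
pose c (v : 'I_n) : 'I_5 := inord (v %% 5).
have tf : triangle_free (blowup C5 c) by apply: triangle_free_blowup triangle_free_C5.
have := Lambda_max_ge hreps hgamma tf; rewrite card_ord => hM.
have := balanced_parts_product n.
rewrite -(eq_bigr _ (fun i _ => card_residue5 n i)) -induced_count_blowup.
rewrite -(ler_nat R) natrD [(17 * _)%:R]natrM [(_ * induced_count _ _)%:R]natrM !natrX => h; apply: le_trans h _.
by rewrite lerD2r ler_wpM2l // exprn_ge0.
Qed.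

(** In the notation set below, $n^5 D \le 2qpD \le 2q n^2 d$, and the pentagon inequality gives $3d
    \le 2(n^5 - qp)$; then $n^2$ cancels. *)
Lemma pentagon_faults_arith (T : finType) (G : sgraph T) f : triangle_free G ->
  (0 < #|T|)%N ->
  (#|pentagons G| * #|faults G f| <= 10 * #|T| ^ 2 * #|defects G|)%N ->
  #|T|%:R ^+ 5 <= 2 * q * (induced_count C5 G)%:R ->
  #|T|%:R ^+ 3 * #|faults G f|%:R * 3 <=
  4 * q * (#|T|%:R ^+ 5 - q * (induced_count C5 G)%:R).
Proof.
move=> tf n0 hf hp.
have hd : 625 * (10 * (induced_count C5 G)%:R) + 3 * #|defects G|%:R <= 2 * #|T|%:R ^+ 5 :> R.
  have := pentagon_inequality tf; rewrite card_pentagons card_aut_C5 -(ler_nat R) natrD.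
  by rewrite [(625 * _)%:R]natrM [(10 * _)%:R]natrM [(3 * _)%:R]natrM [(2 * _)%:R]natrM natrX.
have {}hf : (induced_count C5 G)%:R * #|faults G f|%:R <= #|T|%:R ^+ 2 * #|defects G|%:R :> R.
  rewrite -natrX -!natrM ler_nat; move: hf; rewrite card_pentagons card_aut_C5.
  by rewrite -!mulnA leq_pmul2l.
have n1 : 0 < #|T|%:R :> R by rewrite ltr0n.
move: hp n1 hf hd; set n : R := #|T|%:R; set p : R := (induced_count C5 G)%:R.
set D : R := #|faults G f|%:R; set d : R := #|defects G|%:R => hp n1 hf hd.
have n2 : 0 < n ^+ 2 by rewrite exprn_gt0.
have D0 : 0 <= D by exact: ler0n.
have qE : q = 5 * 625 by rewrite /q; ring.
rewrite -(ler_pM2l n2).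
apply: (@le_trans _ _ (3 * (2 * q * (p * D)))).
  have : n ^+ 5 * D <= 2 * q * p * D by rewrite ler_wpM2r.
  have -> : n ^+ 2 * (n ^+ 3 * D * 3) = 3 * (n ^+ 5 * D) by ring.
  by rewrite -!mulrA => ?; rewrite ler_wpM2l.
have h1 : q * (p * D) <= q * (n ^+ 2 * d) by rewrite ler_wpM2l // qE; lra.
have h2 : n ^+ 2 * (3 * d) <= n ^+ 2 * (2 * (n ^+ 5 - q * p)).
  by rewrite ler_wpM2l ?(ltW n2) // qE; lra.
have h3 : q * (n ^+ 2 * (3 * d)) <= q * (n ^+ 2 * (2 * (n ^+ 5 - q * p))).
  by rewrite ler_wpM2l // qE; lra.
by lra.
Qed.

Lemma min_edit_Lambda_le (T : finType) (G : sgraph T) :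
  triangle_free G -> 68 * q <= #|T|%:R ->
  #|T|%:R ^+ 3 * (min_edit G)%:R <= 80 * q ^+ 3 * (M #|T| - (induced_count C5 G)%:R).
Proof.
move=> tf nq.
have q1 : 1 <= q by rewrite exprn_ege1 // ler1n.
have n0 : (0 < #|T|)%N by rewrite -(ltr_nat R); apply: lt_le_trans nq; lra.
have hM := Lambda_max_balanced #|T|.
(* With at most $n^5/(2q)$ pentagons, the trivial bound on the number of edits suffices. *)
have [few|many] := lerP (2 * q * (induced_count C5 G)%:R) (#|T|%:R ^+ 5).
  apply: few_pentagons_arith => //; rewrite -natrX ler_nat.
  apply: leq_trans (bigminn_le_default _ _ _ _) _.
  exact: bin_le_expn.
have p0 : (0 < #|pentagons G|)%N.
  rewrite card_pentagons muln_gt0 (leq_trans _ card_aut_C5_ge10) //= lt0n.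
  apply: contraTN many => /eqP->; rewrite mulr0 -leNgt exprn_ge0 //.
have [f pf hf] := exists_pentagon_few_faults tf p0.
have ED : (min_edit G)%:R <= #|faults G f|%:R :> R.
  by rewrite ler_nat; apply: leq_trans (edit_count_le tf pf); exact: min_edit_le_class.
apply: (@le_trans _ _ (#|T|%:R ^+ 3 * #|faults G f|%:R)).
  by rewrite ler_wpM2l // exprn_ge0.
have [/existsP[v bv]|] := boolP [exists v, bad G f v].
  apply: many_faults_arith => //; last by rewrite ler_nat (faults_ge_card bv).
  exact: pentagon_faults_arith (ltW many).
rewrite negb_exists => /forallP no_bad.
have hK : (#|T| ^ 5 <= 2 * 5 ^ 5 * induced_count C5 G)%N.
  by rewrite -(ler_nat R) natrM natrM !natrX ltW.
set P := induced_count C5 (blowup C5 (class_of G f)).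
(* The blow-up competes in [M], so no error term arises. The subtraction on the left is truncated,
   hence the two cases. *)
have hP : (P - induced_count C5 G)%:R <= M #|T| - (induced_count C5 G)%:R :> R.
  have [le_PG|/ltnW le_GP] := leqP P (induced_count C5 G).
    by rewrite (eqP le_PG) subr_ge0; exact: Lambda_max_ge.
  rewrite natrB // lerD2r; apply: Lambda_max_ge => //.
  exact: triangle_free_blowup triangle_free_C5.
(* The shape of [no_bad_faults_le] with $K = 2q$, as provided by [hK]. *)
have -> : 80 * q ^+ 3 = 10 * (2 * q) ^+ 3 by ring.
apply: le_trans (_ : 10 * (2 * q) ^+ 3 * (P - induced_count C5 G)%:R <= _); last first.
  by rewrite ler_wpM2l // mulr_ge0 // exprn_ge0 // mulr_ge0 // exprn_ge0.
have := no_bad_faults_le tf pf no_bad n0 hK.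
rewrite -(ler_nat R) mulrC natrM natrX => h; apply: le_trans h _.
by rewrite natrM [(10 * _)%:R]natrM [((_ * _) ^ _)%:R]natrX [(2 * _)%:R]natrM natrX.
Qed.

Lemma pentagon_perfectly_stable : perfectly_stable triangle_family reps gamma C5.
Proof.
(* The factor 4 beyond $80q^3$ comes from $n^2 \le 4\binom n2$. The same constant is the threshold
   on the order and exceeds $68q$. *)
exists (320 * q ^+ 3); first by rewrite mulr_gt0 // !exprn_gt0.
move=> T G /triangle_free_admissible tf hT.
have q1 : 1 <= q by rewrite exprn_ege1 // ler1n.
have nq : 68 * q <= #|T|%:R.
  apply: le_trans hT; apply: ler_pM => //; [lra|lra|].
  by rewrite -[leLHS]expr1 ler_weXn2l.
have := min_edit_Lambda_le tf nq; rewrite /edit_dist -/(min_edit G).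
rewrite /lambda_max /lambda (LambdaE hreps hgamma) -mulrBl -/(M #|T|).
set d := M _ - _ => hE.
have n5 : (5 <= #|T|)%N by rewrite -(ler_nat R); apply: le_trans nq; lra.
set n := #|T| in nq n5 hE *.
have c5 : 0 < 'C(n, 5)%:R :> R by rewrite ltr0n bin_gt0.
have c2 : n%:R ^+ 2 <= 4 * 'C(n, 2)%:R :> R.
  rewrite -natrX -natrM ler_nat bin2; have := odd_double_half (n * n.-1).
  by case: (n) n5 => [|m] // n5 /=; rewrite -mul2n; case: (odd _); nia.
have n0 : 0 < n%:R :> R by rewrite ltr0n (leq_trans _ n5).
have c2' : 0 < 'C(n, 2)%:R :> R by rewrite ltr0n bin_gt0 (leq_trans _ n5).
rewrite ler_pdivrMr //.
have c5le : 'C(n, 5)%:R <= n%:R ^+ 5 :> R.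
  by rewrite -natrX ler_nat bin_le_expn.
have d0 : 0 <= d.
  rewrite -(pmulr_rge0 _ (_ : 0 < 80 * q ^+ 3)); last by rewrite mulr_gt0 // !exprn_gt0.
  by apply: le_trans hE; rewrite mulr_ge0 // exprn_ge0.
rewrite -(ler_pM2l (_ : 0 < n%:R ^+ 3)) ?exprn_gt0 //.
apply: le_trans hE _.
have h1 : d / n%:R ^+ 5 <= d / 'C(n, 5)%:R.
  by rewrite ler_wpM2l // lef_pV2 ?posrE ?exprn_gt0.
have h2 : n%:R ^+ 5 * (d / n%:R ^+ 5) <= n%:R ^+ 5 * (d / 'C(n, 5)%:R).
  by rewrite ler_wpM2l // exprn_ge0 // ltW.
rewrite mulrCA divff ?mulr1 in h2; last by rewrite expf_neq0 // gt_eqF.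
set x := d / 'C(n, 5)%:R in h2 *.
have x0 : 0 <= x by rewrite /x divr_ge0 // ltW.
have n3 : 0 <= n%:R ^+ 3 :> R by rewrite exprn_ge0 // ltW.
have h3 : 80 * q ^+ 3 * d <= 80 * q ^+ 3 * (n%:R ^+ 5 * x).
  by rewrite ler_wpM2l // mulr_ge0 // exprn_ge0 // exprn_ge0.
apply: le_trans h3 _.
have h4 : n%:R ^+ 2 * (80 * q ^+ 3 * (n%:R ^+ 3 * x)) <=
    4 * 'C(n, 2)%:R * (80 * q ^+ 3 * (n%:R ^+ 3 * x)).
  by rewrite ler_wpM2r // !mulr_ge0 // exprn_ge0 // exprn_ge0.
by lra.
Qed.
End Stability.

(** * The unique maximiser *)

Local Open Scope classical_set_scope.
Local Open Scope ring_scope.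

Lemma cvg_linear_rate (R : realType) (u : nat -> R) (x K : R) :
  (forall n, `|u n - x * n%:R| <= K) -> u n / n%:R @[n --> \oo] --> x.
Proof.
move=> hu; apply/cvgrPdist_le => e e0; near=> n.
have n0 : 0 < n%:R :> R by rewrite ltr0n; near: n; exact: nbhs_infty_gt.
have -> : x - u n / n%:R = - ((u n - x * n%:R) / n%:R).
  by rewrite mulrBl mulfK ?gt_eqF // opprB.
rewrite normrN normrM normfV (gtr0_norm n0) ler_pdivrMr //.
apply: le_trans (hu n) _; rewrite mulrC -ler_pdivrMr //.
near: n; exact: nbhs_infty_ger.
Unshelve. all: by end_near. Qed.

(** Truncation does no harm: [t - j] is within [j] of [t] even if [t < j]. *)
Lemma natr_sub_dist (R : realType) (t j n : nat) (K : R) :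
  `|t%:R - n%:R| <= K -> `|(t - j)%N%:R - n%:R| <= K + j%:R :> R.
Proof.
move=> h; have hj : `|(t - j)%N%:R - t%:R| <= j%:R :> R.
  by rewrite distrC -natrB ?leq_subr // ger0_norm // ler_nat; lia.
by rewrite -(subrKA t%:R) addrC (le_trans (ler_normD _ _)) // lerD.
Qed.

Lemma bin_prod_natr (R : realType) t k :
  (k`!)%:R * 'C(t, k)%:R = \prod_(j < k) (t - j)%N%:R :> R.
Proof. by rewrite mulrC -natrM bin_ffact ffact_prod natr_prod. Qed.

Section Maximiser.
Variables (R : realType) (reps : {set sgraph 'I_5}) (gamma : sgraph 'I_5 -> R).
Hypothesis hreps : iso_representatives triangle_family reps.
Hypothesis hgamma : forall H, H \in reps -> gamma H = if iso H C5 then 1 else 0.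

(** Divide the product of the part sizes and the falling factorial of the order by $n^5$: the
    factors tend to $x_i$ and to 1. *)
Lemma C5_blowup_density (x : 'rV[R]_5) : simplex x ->
  is_blowup_density reps gamma C5 x ((5`!)%:R * \prod_i x 0 i).
Proof.
move=> [x_ge0 x_sum] T c hc.
have [K hK] : exists K : R, forall n i,
    `|#|[set v | c n v == i]%SET|%:R - x 0 i * n%:R| <= K.
  have [k hk] := choice hc; exists (\sum_i `|k i|) => n i.
  apply: le_trans (hk i n) _; rewrite (bigD1 i) //= (le_trans (ler_norm _)) // lerDl.
  exact: sumr_ge0.
pose s n i : nat := #|[set v | c n v == i]%SET|.
have cardT n : #|T n| = (\sum_i s n i)%N.
  rewrite -sum1_card (partition_big (c n) predT) //=; apply: eq_bigr => i _.
  by rewrite sum1_card; apply: eq_card => v; rewrite inE.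
(* The order of the blow-up need not be [n]; it is [n] up to the sum of the five part errors. *)
have hT n : `|#|T n|%:R - n%:R| <= 5 * K.
  have -> : n%:R = \sum_i x 0 i * n%:R by rewrite -mulr_suml x_sum mul1r.
  rewrite cardT natr_sum -sumrB.
  apply: (@le_trans _ _ (\sum_(i < 5) K)); last by rewrite sumr_const card_ord mulr_natl.
  by apply: (le_trans (ler_norm_sum _ _ _)); apply: ler_sum => i _; exact: hK.
have hs i : (s n i)%:R / n%:R @[n --> \oo] --> x 0 i.
  by apply: cvg_linear_rate => n; exact: hK.
have ht j : (#|T n| - j)%N%:R / n%:R @[n --> \oo] --> (1 : R).
  by apply: (@cvg_linear_rate _ _ _ (5 * K + j%:R)) => n; rewrite mul1r natr_sub_dist.
have hprod (u : nat -> 'I_5 -> R) (l : 'I_5 -> R) :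
    (forall i, u n i @[n --> \oo] --> l i) ->
    \prod_i u n i @[n --> \oo] --> \prod_i l i.
  by move=> hu; apply: cvg_big => //; exact: mul_continuous.
have -> : (5`!)%:R * \prod_i x 0 i = (5`!)%:R * \prod_i x 0 i / \prod_(j < 5) 1.
  by rewrite [X in _ / X]big1 // divr1.
have lim : (5`!)%:R * \prod_i ((s n i)%:R / n%:R) / \prod_(j < 5) ((#|T n| - j)%N%:R / n%:R)
    @[n --> \oo] --> (5`!)%:R * \prod_i x 0 i / \prod_(j < 5) (1 : R).
  apply: cvgM; first by apply: cvgMr; exact: hprod.
  by apply: cvgV; [rewrite big1 // oner_neq0 | apply: hprod => j; exact: ht].
apply: cvg_trans lim; apply: near_eq_cvg; near=> n.
have n0 : (0 < n)%N by near: n; exact: nbhs_infty_gt.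
rewrite /lambda (LambdaE hreps hgamma) induced_count_blowup natr_prod.
rewrite !big_split /= -bin_prod_natr.
have P0 : \prod_(i < 5) (n%:R)^-1 != 0 :> R.
  by apply/prodf_neq0 => i _; rewrite invr_eq0 pnatr_eq0 -lt0n.
by rewrite mulrA -mulf_div divff // mulr1 invfM mulrACA divff ?mul1r //.
Unshelve. all: by end_near. Qed.

Lemma C5_unique_maximiser :
  unique_density_maximiser reps gamma C5 (const_mx (5%:R^-1)).
Proof.
pose f (x : 'rV[R]_5) := (5`!)%:R * \prod_i x 0 i.
have F0 : 0 < (5`!)%:R :> R by rewrite ltr0n fact_gt0.
(* The relation [leif] carries the equality case of AM-GM, from which uniqueness follows; the mean
   is $1/5$ on the simplex. *)
have agm (x : 'rV[R]_5) : simplex x ->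
    \prod_i x 0 i <= 5^-1 ^+ 5 ?= iff [forall i, forall j, x 0 i == x 0 j].
  move=> [x_ge0 x_sum].
  have := leif_AGM (A := predT) (E := fun i => x 0 i) (fun i _ => x_ge0 i).
  by rewrite /= cardT size_enum_ord x_sum mul1r.
pose u : 'rV[R]_5 := const_mx (5%:R^-1).
have su : simplex u.
  split=> [i|]; first by rewrite mxE invr_ge0.
  under eq_bigr do rewrite mxE.
  by rewrite sumr_const card_ord -[RHS](@mulVf R 5) ?pnatr_eq0 // mulr_natr.
have fu : \prod_i u 0 i = 5^-1 ^+ 5.
  by under eq_bigr do rewrite mxE; rewrite prodr_const card_ord.
exists f; first exact: C5_blowup_density.
apply/seteqP; split=> [x [sx hx]|_ ->] /=; last first.
  by split=> // y sy; rewrite ler_pM2l // fu (agm y sy).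
have eqx : \prod_i x 0 i = 5^-1 ^+ 5.
  apply/eqP; rewrite eq_le (agm x sx) /= -fu.
  by have := hx _ su; rewrite ler_pM2l.
have /eqP := eqx; rewrite (agm x sx) => /forallP h.
apply/rowP => i; rewrite mxE.
have := sx.2; rewrite (eq_bigr (fun=> x 0 i)) => [|j _]; last first.
  by have /forallP/(_ i)/eqP := h j.
rewrite sumr_const card_ord => e.
by apply: (@mulfI R 5%:R); rewrite ?pnatr_eq0 // mulr_natl e divff ?pnatr_eq0.
Qed.
End Maximiser.

Unset Implicit Arguments.

Theorem theorem1p3 (R : realType) (reps : {set sgraph 'I_5})
    (gamma : sgraph 'I_5 -> R)
    (hreps : iso_representatives triangle_family reps)
    (hgamma : forall H, H \in reps -> gamma H = if iso H C5 then 1 else 0) :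
  perfectly_stable triangle_family reps gamma C5 /\
  unique_density_maximiser reps gamma C5 (const_mx (5%:R^-1)).
Proof.
by split; [exact: pentagon_perfectly_stable | exact: C5_unique_maximiser].
Qed.
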